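(* Let $\Bbbk$ be an algebraically closed field of characteristic zero and let $n\ge 1$ be an integer. Then the following hold. (i) For every $d'\in\mathbb{N}$ and every $\underline{d}=(d_1,\dots,d_n)\in\mathbb{N}^n$ there exist constants $a_{\underline{d},d'}$ and $b_{\underline{d},d'}$ in $\mathbb{N}$ with the following property. Let $I$ be a binomial ideal of $\Bbbk[U_1,\dots,U_n]$ generated by binomials $f_1,\dots,f_p$ of degree at most $d'$. Let $i\in\mathbb{N}$ and let $x_1(t,z),\dots,x_n(t,z)\in\Bbbk[[t,z]]$ be such that $\mathrm{ord}(x_j(t,z))=d_j$ for all $j$ and $$f_k(x_1(t,z),\dots,x_n(t,z))\in (t,z)^{a_{\underline{d},d'}\,i+b_{\underline{d},d'}}\quad\text{for all } k.$$ Then there exist $\overline{x}_1(t,z),\dots,\overline{x}_n(t,z)\in\Bbbk[[t,z]]$ such that $f_k(\overline{x}_1(t,z),\dots,\overline{x}_n(t,z))=0$ for all $k$ and $\overline{x}_j(t,z)-x_j(t,z)\in (t,z)^i$ for all $j$. (ii) For every $d'\in\mathbb{N}$ there exists a function $\beta_{d'}:\mathbb{N}\to\mathbb{N}$, doubly exponential in $i$, such that for every binomial ideal $I$ of $\Bbbk[U_1,\dots,U_n]$ generated by binomials of degree at most $d'$, the Artin function of $I\,\Bbbk[[t,z]][U_1,\dots,U_n]$ is bounded by $\beta_{d'}$.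
   Context: A binomial is a polynomial of the form $aU^{\alpha}+bU^{\beta}$ with $a,b\in\Bbbk$ and $\alpha,\beta\in\mathbb{N}^n$ (where $U^\alpha=U_1^{\alpha_1}\cdots U_n^{\alpha_n}$); a binomial ideal is an ideal generated by binomials. $\mathrm{ord}$ denotes the $(t,z)$-adic order on the power series ring $\Bbbk[[t,z]]$. Artin function: for an ideal $I$ of polynomials in $U_1,\dots,U_n$ (with coefficients in $\Bbbk$, or in $\Bbbk[[t,z]]$), the Artin function of $I$ is the smallest function $\beta:\mathbb{N}\to\mathbb{N}$ such that for every $i\in\mathbb{N}$ and all $x_1,\dots,x_n\in\Bbbk[[t,z]]$ with $f(x_1,\dots,x_n)\in (t,z)^{\beta(i)}$ for all $f\in I$, there exist $\overline{x}_1,\dots,\overline{x}_n\in\Bbbk[[t,z]]$ with $f(\overline{x}_1,\dots,\overline{x}_n)=0$ for all $f\in I$ and $\overline{x}_j-x_j\in (t,z)^i$ for all $j$. (Such a function exists by Artin's approximation theorem.) A function is doubly exponential in $i$ if it is of the type $i\mapsto C^{C^{c i}}$ up to lower-order factors, with $C,c$ constants independent of $i$. *)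

(* Defs.v *)
(* Mathematical Components, with the classical axioms of mathcomp-classical. *)
From HB Require Import structures.
From mathcomp Require Import all_boot all_order all_algebra.
From mathcomp Require Import boolp classical_sets.
From mathcomp.multinomials Require Import mpoly.

Set Implicit Arguments.
Unset Strict Implicit.
Unset Printing Implicit Defensive.

Import GRing.Theory.
Local Open Scope ring_scope.

(* The ring k[[t,z]]: scoef f i j is the coefficient of t^i z^j.  The record
   keeps these operations apart from the pointwise ones on functions. *)
Record series2 (K : Type) := Series2 { scoef : nat -> nat -> K }.

HB.instance Definition _ (K : Type) := gen_eqMixin (series2 K).
HB.instance Definition _ (K : Type) := gen_choiceMixin (series2 K).

Section Series2Ring.
Variable K : comNzRingType.
Implicit Types (f g h : series2 K) (p q : {poly {poly K}}).

Lemma series2P f g : (forall i j, scoef f i j = scoef g i j) -> f = g.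
Proof.
case: f g => [f] [g] /= fg; congr Series2.
by apply/funext => i; apply/funext => j; exact: fg.
Qed.

Definition szero : series2 K := Series2 (fun _ _ => 0).
Definition sopp f : series2 K := Series2 (fun i j => - scoef f i j).
Definition sadd f g : series2 K :=
  Series2 (fun i j => scoef f i j + scoef g i j).

Lemma saddA : associative sadd.
Proof. by move=> f g h; apply: series2P => i j /=; rewrite addrA. Qed.
Lemma saddC : commutative sadd.
Proof. by move=> f g; apply: series2P => i j /=; rewrite addrC. Qed.
Lemma sadd0 : left_id szero sadd.
Proof. by move=> f; apply: series2P => i j /=; rewrite add0r. Qed.
Lemma saddN : left_inverse szero sopp sadd.
Proof. by move=> f; apply: series2P => i j /=; rewrite addNr. Qed.

HB.instance Definition _ :=
  GRing.isZmodule.Build (series2 K) saddA saddC sadd0 saddN.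

Definition sconst (c : K) : series2 K :=
  Series2 (fun i j => if (i == 0)%N && (j == 0)%N then c else 0).
Definition smul f g : series2 K :=
  Series2 (fun i j => \sum_(a < i.+1) \sum_(b < j.+1)
                        scoef f a b * scoef g (i - a) (j - b)).

(* Ring identities are checked coefficientwise on polynomials that agree with
   the series up to bidegree (i, j). *)
Definition agree p f i j :=
  forall a b, (a <= i)%N -> (b <= j)%N -> p`_a`_b = scoef f a b.

Definition strunc f i j : {poly {poly K}} :=
  \poly_(a < i.+1) \poly_(b < j.+1) scoef f a b.

Lemma agree_trunc f i j : agree (strunc f i j) f i j.
Proof. by move=> a b ai bj; rewrite !coef_poly ltnS ai coef_poly ltnS bj. Qed.

Lemma agree_mul p q f g i j :
  agree p f i j -> agree q g i j -> agree (p * q) (smul f g) i j.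
Proof.
move=> pf qg a b ai bj; rewrite coefM coef_sum /=.
apply: eq_bigr => -[u /= ua] _; rewrite coefM.
apply: eq_bigr => -[v /= vb] _; congr (_ * _).
  by apply: pf; [exact: leq_trans (ltnSE ua) ai | exact: leq_trans (ltnSE vb) bj].
by apply: qg; apply: (leq_trans (leq_subr _ _)).
Qed.

Lemma smulA : associative smul.
Proof.
move=> f g h; apply: series2P => i j.
have F := @agree_trunc f i j; have G := @agree_trunc g i j.
have H := @agree_trunc h i j.
rewrite -(agree_mul F (agree_mul G H)) // -(agree_mul (agree_mul F G) H) //.
by rewrite mulrA.
Qed.

Lemma smulC : commutative smul.
Proof.
move=> f g; apply: series2P => i j.
have F := @agree_trunc f i j; have G := @agree_trunc g i j.
by rewrite -(agree_mul F G) // -(agree_mul G F) // mulrC.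
Qed.

Lemma smul1 : left_id (sconst 1) smul.
Proof.
move=> f; apply: series2P => i j /=.
rewrite big_ord_recl big_ord_recl /= !subn0 mul1r !big1 ?addr0 //.
- by move=> a _; apply: big1 => b _; rewrite mul0r.
- by move=> b _; rewrite mul0r.
Qed.

Lemma smulDl : left_distributive smul +%R.
Proof.
move=> f g h; apply: series2P => i j /=; rewrite -big_split.
apply: eq_bigr => a _; rewrite -big_split; apply: eq_bigr => b _.
by rewrite /= mulrDl.
Qed.

Lemma sconst1_neq0 : sconst 1 != 0.
Proof.
apply/eqP => /(congr1 (fun f => scoef f 0 0)) /= /eqP.
by rewrite oner_eq0.
Qed.

HB.instance Definition _ :=
  GRing.Zmodule_isComNzRing.Build (series2 K) smulA smulC smul1 smulDl
    sconst1_neq0.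

Definition tvar : series2 K :=
  Series2 (fun i j => if (i == 1)%N && (j == 0)%N then 1 else 0).
Definition zvar : series2 K :=
  Series2 (fun i j => if (i == 0)%N && (j == 1)%N then 1 else 0).

Lemma sconst_zmod_morphism : zmod_morphism sconst.
Proof.
by move=> c d; apply: series2P => i j /=; case: ifP => _; rewrite ?subr0.
Qed.

Lemma sconst_monoid_morphism : monoid_morphism sconst.
Proof.
split=> // c d; apply: series2P => i j /=.
rewrite big_ord_recl big_ord_recl /= !subn0 !big1.
- by rewrite !addr0; case: ifP => _; rewrite ?mulr0.
- by move=> a _; apply: big1 => b _; rewrite mul0r.
- by move=> b _; rewrite mul0r.
Qed.

HB.instance Definition _ :=
  GRing.isZmodMorphism.Build K (series2 K) sconst sconst_zmod_morphism.
HB.instance Definition _ :=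
  GRing.isMonoidMorphism.Build K (series2 K) sconst sconst_monoid_morphism.

End Series2Ring.

Section Ideals.
Variable R : comNzRingType.

Definition ideal_gen (S : set R) : set R :=
  [set x | exists (m : nat) (c s : 'I_m -> R),
     (forall k, S (s k)) /\ x = \sum_(k < m) c k * s k].

Definition ideal_mul (A B : set R) : set R :=
  ideal_gen [set x | exists a b, [/\ A a, B b & x = a * b]].

Fixpoint ideal_exp (A : set R) (i : nat) : set R :=
  if i is i'.+1 then ideal_mul A (ideal_exp A i') else setT.

End Ideals.

Definition tz_exp (K : comNzRingType) (i : nat) : set (series2 K) :=
  ideal_exp (ideal_gen [set tvar K; zvar K]) i.

(* The (t,z)-adic order of x is the finite number d; in particular x <> 0. *)
Definition tz_ord (K : comNzRingType) (x : series2 K) (d : nat) : Prop :=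
  tz_exp d x /\ ~ tz_exp d.+1 x.

Definition extend_coef (K : comNzRingType) (n : nat) (f : {mpoly K[n]}) :
  {mpoly (series2 K)[n]} := map_mpoly (@sconst K) f.

Definition extend_ideal (K : comNzRingType) (n : nat) (I : set {mpoly K[n]}) :
  set {mpoly (series2 K)[n]} := ideal_gen (@extend_coef K n @` I).

(* The coefficients may vanish and the exponents may coincide. *)
Definition is_binomial (K : comNzRingType) (n : nat) (f : {mpoly K[n]}) : Prop :=
  exists (a b : K) (u v : 'X_{1..n}), f = a *: 'X_[u] + b *: 'X_[v].

(* As msize is 1 + degree (and 0 at the zero polynomial), the second condition
   says that the total degree is at most d. *)
Definition binomial_deg_le (K : comNzRingType) (n d : nat) (f : {mpoly K[n]}) :
  Prop := is_binomial f /\ (msize f <= d.+1)%N.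

Definition artin_approx (K : comNzRingType) (n : nat)
    (J : set {mpoly (series2 K)[n]}) (i m : nat) : Prop :=
  forall x : 'I_n -> series2 K,
    (forall f, J f -> tz_exp m f.@[x]) ->
    exists y : 'I_n -> series2 K,
      (forall f, J f -> f.@[y] = 0) /\ (forall j, tz_exp i (y j - x j)).

(* beta is the (necessarily unique) pointwise smallest function with the
   approximation property. *)
Definition is_artin_function (K : comNzRingType) (n : nat)
    (J : set {mpoly (series2 K)[n]}) (beta : nat -> nat) : Prop :=
  (forall i, artin_approx J i (beta i)) /\
  (forall gamma : nat -> nat,
     (forall i, artin_approx J i (gamma i)) -> forall i, (beta i <= gamma i)%N).

Definition lower_order (E g : nat -> nat) : Prop :=
  forall e : nat, exists N : nat, forall i, (N <= i)%N -> (g i ^ e <= E i)%N.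

(* beta i equals C^(C^(c i)) up to a factor (in either direction) all of whose
   powers are eventually below C^(C^(c i)). *)
Definition doubly_exponential (beta : nat -> nat) : Prop :=
  exists C c : nat, [/\ (1 < C)%N, (0 < c)%N &
    let E i := (C ^ (C ^ (c * i)))%N in
    exists g : nat -> nat, lower_order E g /\
      forall i, (beta i <= g i * E i)%N /\ (E i <= g i * beta i)%N].

(* Main.v *)
From HB Require Import structures.
Require Import Defs.
From mathcomp Require Import all_boot all_order all_algebra.
From mathcomp Require Import boolp classical_sets.
From mathcomp.multinomials Require Import mpoly.
From mathcomp Require Import cyclic separable cyclotomic.
From mathcomp Require Import zify ring.

Set Implicit Arguments.
Unset Strict Implicit.
Unset Printing Implicit Defensive.

Import GRing.Theory.
Local Open Scope ring_scope.

(** Why approximate solutions of a binomial system are close to solutions.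

    Let the components x_j have orders d_j, and choose coordinates (t, z) such that
    t divides none of their leading forms; t - c z will do for generic c.  In the
    chart t = s, z = s T of the blow-up of the origin ([blowup])
    each x_j factors as s^(d_j) U_j P_j with U_j a unit and P_j a monic
    polynomial of degree d_j in T over K[[s]] ([weierstrass]), and conversely
    every such product is a series in (t, z) if the degrees in T of U_j are
    suitably bounded.  The factorisation of a series being unique, even modulo
    powers of s ([weierstrass_uniq]), an equation between two monomials in the
    x_j, valid modulo s^N, holds separately for the exponents of s, for the units
    and for the polynomials, modulo s^(N - delta), where delta is the order of
    the monomials.  Each part is then made exact.

    For the units, the logarithmic derivative makes the equations linear with
    integer coefficients, and truncation solves them ([toric_units]).

    For the polynomials, Puiseux's theorem ([puiseux_split_family]) gives roots in
    K[[s^(1/M)]].  If two products of linear factors agree modulo a power of s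
    greater than delta times k, every ball of radius s^k contains equally many
    roots of both ([cluster_count]).  Hence the equations become exact when every
    root is moved to the mean of the roots of all P_j in its ball.  Taking means
    commutes with the Galois group, generated by a substitution of zeta s^(1/M)
    for s^(1/M), so the new polynomials still have coefficients in K[[s]]
    ([toric_polys]).  The loss of precision is affine in the target precision,
    with coefficients depending on the orders ([approx_bounded_order]).

    A monomial with nonzero coefficient cannot vanish to an order larger than its
    own, so for components of given orders only equations between two monomials
    remain, which is the first part.  In general the orders of n components miss
    one of n + 1 consecutive gaps between thresholds growing geometrically
    ([order_gap]); components above the gap are replaced by 0, and those below it
    have bounded order ([approx_gap]).  The precision needed is quadratic in i,
    which is less than a double exponential. *)

(** * Power series in one variable *)

Record ser (R : Type) := Ser { sc : nat -> R }.

HB.instance Definition _ (R : Type) := gen_eqMixin (ser R).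
HB.instance Definition _ (R : Type) := gen_choiceMixin (ser R).

Section SerRing.
Variable R : comNzRingType.
Implicit Types (f g h : ser R).

Lemma serP f g : (forall k, sc f k = sc g k) -> f = g.
Proof. by case: f g => [f] [g] /= fg; congr Ser; apply/funext. Qed.

Definition ser0 : ser R := Ser (fun=> 0).
Definition ser_opp f : ser R := Ser (fun k => - sc f k).
Definition ser_add f g : ser R := Ser (fun k => sc f k + sc g k).

Lemma ser_addA : associative ser_add.
Proof. by move=> f g h; apply: serP => k /=; rewrite addrA. Qed.
Lemma ser_addC : commutative ser_add.
Proof. by move=> f g; apply: serP => k /=; rewrite addrC. Qed.
Lemma ser_add0 : left_id ser0 ser_add.
Proof. by move=> f; apply: serP => k /=; rewrite add0r. Qed.
Lemma ser_addN : left_inverse ser0 ser_opp ser_add.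
Proof. by move=> f; apply: serP => k /=; rewrite addNr. Qed.

HB.instance Definition _ :=
  GRing.isZmodule.Build (ser R) ser_addA ser_addC ser_add0 ser_addN.

Definition ser_const (c : R) : ser R := Ser (fun k => if k == 0%N then c else 0).
Definition ser_mul f g : ser R :=
  Ser (fun k => \sum_(l < k.+1) sc f l * sc g (k - l)).

Definition ser_trunc f k : {poly R} := \poly_(l < k.+1) sc f l.

Lemma coef_ser_trunc f k l : (l <= k)%N -> (ser_trunc f k)`_l = sc f l.
Proof. by move=> lk; rewrite coef_poly ltnS lk. Qed.

(* The ring identities hold because they hold for polynomial truncations. *)
Lemma coef_ser_mul (p q : {poly R}) f g k :
  (forall l, (l <= k)%N -> p`_l = sc f l) ->
  (forall l, (l <= k)%N -> q`_l = sc g l) ->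
  forall l, (l <= k)%N -> (p * q)`_l = sc (ser_mul f g) l.
Proof.
move=> pf qg l lk; rewrite coefM; apply: eq_bigr => -[a /= al] _.
rewrite pf ?qg //; first exact: leq_trans (leq_subr _ _) lk.
exact: leq_trans (ltnSE al) lk.
Qed.

Lemma ser_mulA : associative ser_mul.
Proof.
move=> f g h; apply: serP => k.
have F := @coef_ser_trunc f k; have G := @coef_ser_trunc g k.
have H := @coef_ser_trunc h k.
rewrite -(coef_ser_mul F (coef_ser_mul G H)) //.
by rewrite -(coef_ser_mul (coef_ser_mul F G) H) // mulrA.
Qed.

Lemma ser_mulC : commutative ser_mul.
Proof.
move=> f g; apply: serP => k.
have F := @coef_ser_trunc f k; have G := @coef_ser_trunc g k.
by rewrite -(coef_ser_mul F G) // -(coef_ser_mul G F) // mulrC.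
Qed.

Lemma ser_mul1 : left_id (ser_const 1) ser_mul.
Proof.
move=> f; apply: serP => k /=; rewrite big_ord_recl /= subn0 mul1r big1 ?addr0 //.
by move=> l _; rewrite mul0r.
Qed.

Lemma ser_mulDl : left_distributive ser_mul +%R.
Proof.
move=> f g h; apply: serP => k /=; rewrite -big_split.
by apply: eq_bigr => l _; rewrite /= mulrDl.
Qed.

Lemma ser_const1_neq0 : ser_const 1 != 0.
Proof.
by apply/eqP => /(congr1 (fun f => sc f 0)) /= /eqP; rewrite oner_eq0.
Qed.

HB.instance Definition _ :=
  GRing.Zmodule_isComNzRing.Build (ser R) ser_mulA ser_mulC ser_mul1 ser_mulDl
    ser_const1_neq0.

Arguments sc : simpl never.

Lemma sc0 k : sc (0 : ser R) k = 0. Proof. by []. Qed.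
Lemma scD f g k : sc (f + g) k = sc f k + sc g k. Proof. by []. Qed.
Lemma scN f k : sc (- f) k = - sc f k. Proof. by []. Qed.
Lemma scB f g k : sc (f - g) k = sc f k - sc g k. Proof. by []. Qed.
Lemma sc_const c k : sc (ser_const c) k = if k == 0%N then c else 0.
Proof. by []. Qed.
Lemma scM f g k : sc (f * g) k = \sum_(l < k.+1) sc f l * sc g (k - l).
Proof. by []. Qed.

Lemma scMr f g k : sc (f * g) k = \sum_(l < k.+1) sc f (k - l) * sc g l.
Proof. by rewrite mulrC scM; apply: eq_bigr => l _; rewrite mulrC. Qed.

Lemma sc1 k : sc (1 : ser R) k = if k == 0%N then 1 else 0.
Proof. by []. Qed.

Lemma scM0 f g : sc (f * g) 0 = sc f 0 * sc g 0.
Proof. by rewrite scM big_ord1 subnn. Qed.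

Definition coef_ser k f := sc f k.
Lemma coef_ser_zmod_morphism k : zmod_morphism (coef_ser k).
Proof. by []. Qed.
HB.instance Definition _ k :=
  GRing.isZmodMorphism.Build (ser R) R (coef_ser k) (coef_ser_zmod_morphism k).

Lemma sc_sum k (I : Type) (r : seq I) (P : pred I) (F : I -> ser R) :
  sc (\sum_(i <- r | P i) F i) k = \sum_(i <- r | P i) sc (F i) k.
Proof. exact: (raddf_sum (coef_ser k)). Qed.

Lemma sc0_prod (I : Type) (r : seq I) (P : pred I) (F : I -> ser R) :
  sc (\prod_(i <- r | P i) F i) 0 = \prod_(i <- r | P i) sc (F i) 0.
Proof. by apply: (big_morph (coef_ser 0)) => // f g; apply: scM0. Qed.

Lemma sc0X f n : sc (f ^+ n) 0 = sc f 0 ^+ n.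
Proof. by elim: n => // n IH; rewrite !exprS scM0 IH. Qed.

Lemma ser_const_zmod_morphism : zmod_morphism ser_const.
Proof. by move=> c d; apply: serP => k; rewrite scB !sc_const; case: ifP => _; rewrite ?subr0. Qed.

Lemma sc_constM c f k : sc (ser_const c * f) k = c * sc f k.
Proof.
rewrite scM big_ord_recl sc_const /= subn0 big1 ?addr0 // => l _.
by rewrite sc_const mul0r.
Qed.

Lemma ser_const_monoid_morphism : monoid_morphism ser_const.
Proof.
by split=> // c d; apply: serP => k; rewrite sc_constM !sc_const; case: ifP; rewrite ?mulr0.
Qed.

HB.instance Definition _ :=
  GRing.isZmodMorphism.Build R (ser R) ser_const ser_const_zmod_morphism.
HB.instance Definition _ :=
  GRing.isMonoidMorphism.Build R (ser R) ser_const ser_const_monoid_morphism.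

Definition svar : ser R := Ser (fun k => if k == 1%N then 1 else 0).

Lemma sc_svar k : sc svar k = if k == 1%N then 1 else 0. Proof. by []. Qed.

Lemma sc_svarXM d f k :
  sc (svar ^+ d * f) k = if (k < d)%N then 0 else sc f (k - d).
Proof.
elim: d f k => [|d IH] f k; first by rewrite mul1r subn0.
rewrite exprS -mulrA; case: k => [|k]; first by rewrite scM0 sc_svar mul0r.
rewrite scM big_ord_recl big_ord_recl [X in _ + (_ + X)]big1 => [|l _].
  by rewrite !sc_svar /bump /= mul0r mul1r add0r addr0 subn1 IH ltnS subSS.
by rewrite sc_svar mul0r.
Qed.

(** Congruence modulo s^N. *)
Definition eqmod N f g := forall k, (k < N)%N -> sc f k = sc g k.

Lemma eqmodM N f f' g g' :
  eqmod N f f' -> eqmod N g g' -> eqmod N (f * g) (f' * g').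
Proof.
move=> ff gg k kN; rewrite !scM; apply: eq_bigr => -[l /= lk] _.
rewrite ff ?gg //; first exact: leq_ltn_trans (leq_subr _ _) kN.
exact: leq_ltn_trans (ltnSE lk) kN.
Qed.

(** Power series are mostly found by solving for one coefficient after the
    other; the list of the values found so far carries the recursion. *)
Fixpoint rec_hist (A : Type) (a0 : A) (step : nat -> (nat -> A) -> A) k : seq A :=
  if k is k'.+1 then
    rcons (rec_hist a0 step k') (step k' (nth a0 (rec_hist a0 step k')))
  else [::].

Lemma strong_rec (A : Type) (a0 : A) (step : nat -> (nat -> A) -> A) :
  exists f : nat -> A,
    forall k, f k = step k (fun l => if (l < k)%N then f l else a0).
Proof.
pose f k := nth a0 (rec_hist a0 step k.+1) k.
have sz k : size (rec_hist a0 step k) = k.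
  by elim: k => //= k IH; rewrite size_rcons IH.
have fE k l : (l < k)%N -> nth a0 (rec_hist a0 step k) l = f l.
  elim: k => // k IH; rewrite ltnS leq_eqVlt => /predU1P[-> //|lk].
  by rewrite /= nth_rcons sz lk IH.
exists f => k; rewrite {1}/f /= nth_rcons sz ltnn eqxx.
congr (step k _); apply/funext => l; case: ifP => [/fE //|/negbT].
by rewrite -leqNgt => kl; rewrite nth_default ?sz.
Qed.

End SerRing.
#[global] Arguments sc : simpl never.

(** * Orders of series over a domain *)

Section SerOrder.
Variable R : idomainType.
Implicit Types (f g : ser R).

Definition has_order n f := eqmod n f 0 /\ sc f n != 0.

Lemma has_orderM m n f g :
  has_order m f -> has_order n g -> has_order (m + n) (f * g).
Proof.
move=> [f0 fm] [g0 gn]; split=> [k kmn|].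
  rewrite scM big1 // => -[l /= lk] _.
  case: (ltnP l m) => [/f0 -> |ml]; first by rewrite sc0 mul0r.
  rewrite g0 ?sc0 ?mulr0 // ltn_subLR //; apply: leq_trans kmn _.
  by rewrite leq_add2r.
have mlt : (m < (m + n).+1)%N by rewrite ltnS leq_addr.
rewrite scM (bigD1 (Ordinal mlt)) //= big1 => [|[l /= lk] /eqP lm].
  by rewrite addr0 addKn mulf_neq0.
case: (ltngtP l m) => [/f0 ->|ml|E]; first by rewrite sc0 mul0r.
  by rewrite g0 ?sc0 ?mulr0 // ltn_subLR // ltn_add2r.
by case: lm; apply: val_inj.
Qed.

Lemma has_order1 : has_order 0 (1 : ser R).
Proof. by split=> //; rewrite sc1 oner_eq0. Qed.

Lemma has_orderX n f e : has_order n f -> has_order (e * n) (f ^+ e).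
Proof.
move=> fn; elim: e => [|e IH]; first exact: has_order1.
by rewrite exprS mulSn; apply: has_orderM.
Qed.

Lemma has_order_prod (I : Type) (r : seq I) (n : I -> nat) (F : I -> ser R) :
  (forall i, has_order (n i) (F i)) ->
  has_order (\sum_(i <- r) n i) (\prod_(i <- r) F i).
Proof.
move=> nF; elim: r => [|i r IH]; first by rewrite !big_nil; apply: has_order1.
by rewrite !big_cons; apply: has_orderM.
Qed.

Lemma has_order_uniq m n f : has_order m f -> has_order n f -> m = n.
Proof.
move=> [f0 fm] [g0 fn]; case: (ltngtP m n) => // [/g0 E|/f0 E].
  by rewrite E sc0 eqxx in fm.
by rewrite E sc0 eqxx in fn.
Qed.

Lemma has_order_eqmod N n f g :
  eqmod N f g -> (n < N)%N -> has_order n f -> has_order n g.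
Proof.
move=> fg nN [f0 fn]; split=> [k kn|]; last by rewrite -fg.
by rewrite -fg ?f0 // (ltn_trans kn).
Qed.

Lemma has_order_le N n f : eqmod N f 0 -> has_order n f -> (N <= n)%N.
Proof.
by move=> f0 [_ fn]; rewrite leqNgt; apply/negP => /f0 E; rewrite E sc0 eqxx in fn.
Qed.

Lemma ex_has_order f : f != 0 -> exists n, has_order n f.
Proof.
move=> f0; have ex : exists n, sc f n != 0.
  apply: contrapT => /forallNP H; case/eqP: f0; apply: serP => k.
  by rewrite sc0; apply/eqP; apply: contrapT => /negP /H.
case: (ex_minnP ex) => n fn nmin; exists n; split=> // k kn.
by rewrite sc0; apply/eqP; apply: contraLR kn => /nmin; rewrite -leqNgt.
Qed.

(** Inverses are chosen classically: their only use is to give series over a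
    domain the structure of an integral domain. *)
Definition ser_unit : pred (ser R) := fun f => `[< exists g, g * f = 1 >].
Definition ser_inv f : ser R :=
  if pselect (exists g, g * f = 1) is left P then projT1 (cid P) else f.

Lemma ser_mulVr : {in ser_unit, left_inverse 1 ser_inv *%R}.
Proof.
move=> f /asboolP fU; rewrite /ser_inv; case: pselect => // P.
exact: (projT2 (cid P)).
Qed.
Lemma ser_unitP f g : g * f = 1 -> ser_unit f.
Proof. by move=> gf; apply/asboolP; exists g. Qed.
Lemma ser_inv_out : {in [predC ser_unit], ser_inv =1 id}.
Proof.
by move=> f /asboolP fU; rewrite /ser_inv; case: pselect.
Qed.

HB.instance Definition _ := GRing.ComNzRing_hasMulInverse.Build (ser R)
  ser_mulVr ser_unitP ser_inv_out.

Lemma ser_mulf_eq0 f g : f * g = 0 -> (f == 0) || (g == 0).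
Proof.
move=> fg; apply: contrapT => /negP; rewrite negb_or => /andP[].
move=> /ex_has_order[m fm] /ex_has_order[n gn].
by case: (has_orderM fm gn) => _; rewrite fg sc0 eqxx.
Qed.

HB.instance Definition _ := GRing.ComUnitRing_isIntegral.Build (ser R) ser_mulf_eq0.

Lemma has_order0 f : sc f 0 != 0 -> has_order 0 f.
Proof. by []. Qed.

End SerOrder.

(** * Polynomials with series coefficients, and Hensel's lemma *)

Section PolySer.
Variable R : comNzRingType.
Implicit Types (p q : {poly ser R}) (F : ser {poly R}).

(** The embedding of R[[s]][T] into R[T][[s]]. Roots are taken on the left,
    while congruences modulo s^N and Euclidean division by a leading form are
    statements about the right. *)
Definition swap p : ser {poly R} := Ser (fun k => map_poly (coef_ser k) p).

Lemma coef_swap p k i : (sc (swap p) k)`_i = sc p`_i k.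
Proof. by rewrite /sc /= coef_map_id0 ?raddf0. Qed.

Lemma swap_zmod_morphism : zmod_morphism swap.
Proof.
move=> p q; apply: serP => k; apply/polyP => i.
by rewrite scB coefB !coef_swap coefB.
Qed.

Lemma swap_monoid_morphism : monoid_morphism swap.
Proof.
split=> [|p q]; apply: serP => k; apply/polyP => i; rewrite coef_swap.
  rewrite coef1 sc1; case: i => [|i]; rewrite ?sc1; case: ifP => //.
    by rewrite coef1.
  by rewrite coef0.
  by rewrite coef1.
  by rewrite coef0.
rewrite coefM sc_sum scM coef_sum.
under eq_bigr do rewrite scM.
rewrite exchange_big; apply: eq_bigr => l _ /=; rewrite coefM.
by apply: eq_bigr => a _; rewrite !coef_swap.
Qed.

HB.instance Definition _ :=
  GRing.isZmodMorphism.Build {poly ser R} (ser {poly R}) swap swap_zmod_morphism.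
HB.instance Definition _ :=
  GRing.isMonoidMorphism.Build {poly ser R} (ser {poly R}) swap
    swap_monoid_morphism.

Lemma swap_inj : injective swap.
Proof.
move=> p q pq; apply/polyP => i; apply: serP => k.
by rewrite -!coef_swap pq.
Qed.

Lemma size_swap p k : (size (sc (swap p) k) <= size p)%N.
Proof.
apply/leq_sizeP => i pi; rewrite coef_swap nth_default //.
Qed.

Lemma swap_onto n F : (forall k, (size (sc F k) <= n)%N) ->
  exists2 p, swap p = F & (size p <= n)%N.
Proof.
move=> Fn; exists (\poly_(i < n) Ser (fun k => (sc F k)`_i)); last exact: size_poly.
apply: serP => k; apply/polyP => i; rewrite coef_swap coef_poly.
by case: ltnP => // ni; rewrite sc0 nth_default // (leq_trans (Fn k)).
Qed.

Lemma monic_sizeP n (p : {poly ser R}) : (size p <= n.+1)%N -> p`_n = 1 ->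
  p \is monic /\ size p = n.+1.
Proof.
move=> sp pn; have sz : size p = n.+1.
  apply/eqP; rewrite eqn_leq sp ltnNge /=; apply/negP => /leq_sizeP /(_ n (leqnn n)).
  by rewrite pn => /eqP; rewrite oner_eq0.
by split=> //; rewrite monicE lead_coefE sz pn.
Qed.

End PolySer.

Section Hensel.
Variable K : fieldType.
Implicit Types (F G H : ser {poly K}).

(** Comparing the coefficients of s^k in F = G H gives G_k H_0 + H_k G_0 = C_k
    with C_k depending on earlier coefficients only.  Bezout's identity solves
    it, and Euclidean division by G_0 makes G_k of degree less than G_0.  The
    slope w of the degree bound is 0 when F comes from R[[s]][T], and 1 when F
    is the blow-up of a series in two variables. *)
Lemma hensel (w : nat) F (G0 H0 : {poly K}) :
  sc F 0 = G0 * H0 -> G0 != 0 -> H0 != 0 -> coprimep G0 H0 ->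
  (forall k, (size (sc F k) <= size (sc F 0) + w * k)%N) ->
  exists G H, [/\ F = G * H, sc G 0 = G0 /\ sc H 0 = H0,
    forall k, (0 < k)%N -> (size (sc G k) < size G0)%N &
    forall k, (size (sc H k) <= size H0 + w * k)%N].
Proof.
move=> F0 G0n H0n /Bezout_eq1_coprimepP[[A B] /= AB] sF.
pose C k (h : nat -> {poly K} * {poly K}) :=
  sc F k.+1 - \sum_(l < k) (h l.+1).1 * (h (k - l)%N).2.
pose step k h := if k is k'.+1 then
  let g := (B * C k' h) %% G0 in (g, (C k' h - g * H0) %/ G0) else (G0, H0).
have [h hE] := strong_rec (0, 0) step.
have h0 : h 0 = (G0, H0) by rewrite hE.
have CE k : C k (fun l => if (l < k.+1)%N then h l else (0, 0)) = C k h.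
  congr (_ - _); apply: eq_bigr => -[l /= lk] _.
  by rewrite !ltnS lk leq_subr.
have h1 k : (h k.+1).1 = (B * C k h) %% G0 by rewrite hE /= CE.
have h2 k : (h k.+1).2 = (C k h - (h k.+1).1 * H0) %/ G0.
  by rewrite h1 hE /= CE.
have hC k : (h k.+1).2 * G0 = C k h - (h k.+1).1 * H0.
  rewrite h2 divpK // h1; move: (C k h) => c.
  have -> : c - (B * c) %% G0 * H0 = (A * c + (B * c) %/ G0 * H0) * G0.
    have cE : c = A * c * G0 + B * c * H0.
      transitivity ((A * G0 + B * H0) * c); last ring.
      by rewrite AB mul1r.
    rewrite {1}cE; have := divp_eq (B * c) G0.
    by move: (_ %/ _) (_ %% _) => q r ->; ring.
  by rewrite dvdp_mulIr.
have sG k : (0 < k)%N -> (size (h k).1 < size G0)%N.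
  by case: k => // k _; rewrite h1 ltn_modp.
have G0s : (0 < size G0)%N by rewrite size_poly_gt0.
have sMul (G : {poly K}) k j : (size G < size G0)%N -> (j <= k)%N ->
    forall H : {poly K}, (size H <= size H0 + w * j)%N ->
    (size (G * H)%R <= (size G0 + size H0).-1 + w * k)%N.
  move=> sG' jk H sH; apply: leq_trans (size_polyMleq _ _) _.
  have : (w * j <= w * k)%N by rewrite leq_mul2l jk orbT.
  lia.
have sH k : (size (h k).2 <= size H0 + w * k)%N.
  have [m] := ubnP k; elim: m k => // m IH [|k] km.
    by rewrite h0 muln0 addn0.
  have : (size ((h k.+1).2 * G0)%R <= (size G0 + size H0).-1 + w * k.+1)%N.
    rewrite hC; apply: leq_trans (size_polyD _ _) _.
    rewrite geq_max size_polyN; apply/andP; split; last first.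
      by apply: (sMul _ _ 0%N) => //; [exact: sG | rewrite muln0 addn0].
    apply: leq_trans (size_polyD _ _) _.
    rewrite geq_max size_polyN; apply/andP; split.
      by apply: leq_trans (sF _) _; rewrite F0 size_mul.
    apply: (big_ind (fun p : {poly K} => (size p <= (size G0 + size H0).-1 + w * k.+1)%N)).
    - by rewrite size_poly0.
    - move=> x y sx sy; apply: leq_trans (size_polyD _ _) _.
      by rewrite geq_max sx sy.
    - move=> [l /= lk] _; apply: (sMul _ _ (k - l)%N).
      + exact: sG.
      + by apply: leq_trans (leq_subr _ _) _.
      + by apply: IH; apply: leq_ltn_trans (leq_subr _ _) _.
  have [->|hn] := eqVneq (h k.+1).2 0; first by rewrite size_poly0.
  have : (0 < size (h k.+1).2)%N by rewrite size_poly_gt0.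
  rewrite size_mul //; move: (w * k.+1)%N G0s; clear.
  by move: (size _) (size _) (size _) => a b c; lia.
exists (Ser (fun k => (h k).1)), (Ser (fun k => (h k).2)); split=> //.
  apply: serP => -[|k]; rewrite scM.
    by rewrite big_ord1 F0 /sc /= h0.
  rewrite big_ord_recl big_ord_recr /= /bump /= add1n subnn subn0.
  rewrite /sc /= -/(sc F k.+1) h0 /= mulrC hC.
  have -> : \sum_(i < k) (h (1 + i)%N).1 * (h (k.+1 - (1 + i))%N).2 =
            \sum_(i < k) (h i.+1).1 * (h (k - i)%N).2.
    by apply: eq_bigr => i _; rewrite add1n subSS.
  by rewrite addrA addrAC addrNK /C subrK.
by rewrite /sc /= h0.
Qed.

End Hensel.

Section HenselCor.
Variable K : fieldType.

(** Weierstrass preparation in the blow-up chart is the lifting of the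
    factorisation of the leading form into a constant and a monic polynomial. *)
Lemma weierstrass d (F : ser {poly K}) :
  size (sc F 0) = d.+1 -> (forall k, (size (sc F k) <= (d + k).+1)%N) ->
  exists (U : ser {poly K}) (P : {poly ser K}) (c : K),
  [/\ F = U * swap P, P \is monic /\ size P = d.+1, sc U 0 = c%:P /\ c != 0 &
      forall k, (size (sc U k) <= k.+1)%N].
Proof.
move=> s0 sF; set c := lead_coef (sc F 0).
have F0n : sc F 0 != 0 by rewrite -size_poly_gt0 s0.
have cn : c != 0 by rewrite lead_coef_eq0.
have cinv : c^-1 != 0 by rewrite invr_neq0.
have [|||||G [H [FE [G0 H0] sG sH]]] :=
    @hensel _ 1 F (c^-1 *: sc F 0) c%:P.
- by rewrite mulrC mul_polyC scalerA divff // scale1r.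
- by rewrite scaler_eq0 negb_or cinv.
- by rewrite polyC_eq0.
- by rewrite -alg_polyC coprimepZr // coprimep1.
- by move=> k; rewrite s0 mul1n addSn.
have sG0 : size (c^-1 *: sc F 0) = d.+1 by rewrite size_scale.
have [k|P PE sP] := @swap_onto _ d.+1 G.
  by case: k => [|k]; rewrite ?G0 ?sG0 // ltnW // -sG0 sG.
have Pd : P`_d = 1.
  apply: serP => k; rewrite -coef_swap PE sc1; case: k => [|k] /=.
    rewrite G0 coefZ; have -> : (sc F 0)`_d = c by rewrite /c lead_coefE s0.
    by rewrite mulVf.
  by rewrite nth_default //; have := sG k.+1 isT; rewrite sG0 ltnS.
exists H, P, c; split.
- by rewrite PE mulrC.
- exact: monic_sizeP.
- by [].
- move=> k; apply: leq_trans (sH k) _.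
  by rewrite mul1n size_polyC cn add1n.
Qed.

Lemma hensel_poly (P : {poly ser K}) (G0 H0 : {poly K}) :
  P \is monic -> map_poly (coef_ser 0) P = G0 * H0 -> G0 \is monic ->
  coprimep G0 H0 ->
  exists G H : {poly ser K}, [/\ P = G * H, G \is monic & size G = size G0].
Proof.
move=> Pm P0 G0m cop.
have [d sP] : exists d, size P = d.+1.
  by exists (size P).-1; rewrite prednK // size_poly_gt0 monic_neq0.
have s0 : size (sc (swap P) 0) = d.+1.
  apply/eqP; rewrite eqn_leq -{1}sP size_swap /= ltnNge.
  apply/negP => /leq_sizeP /(_ d (leqnn d)).
  have := monicP Pm; rewrite lead_coefE sP coef_swap /= => ->.
  by move/eqP; rewrite oner_eq0.
have H0n : H0 != 0.
  apply/eqP => E; move: s0; rewrite /sc /= P0 E mulr0 size_poly0.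
  by [].
have [||G [H [FE [G0E H0E] sG sH]]] := @hensel _ 0 (swap P) G0 H0 P0 _ H0n cop.
- exact: monic_neq0.
- by move=> k; rewrite s0 mul0n addn0 -sP size_swap.
have [e sG0] : exists e, size G0 = e.+1.
  by exists (size G0).-1; rewrite prednK // size_poly_gt0 monic_neq0.
have [k|G' GE sG'] := @swap_onto _ e.+1 G.
  by case: k => [|k]; rewrite ?G0E ?sG0 // ltnW // -sG0 sG.
have [|H' HE _] := @swap_onto _ (size H0) H.
  by move=> k; apply: leq_trans (sH k) _; rewrite mul0n addn0.
have [] := @monic_sizeP _ e G' sG'.
  apply: serP => k; rewrite -coef_swap GE sc1; case: k => [|k] /=.
    by have := monicP G0m; rewrite G0E lead_coefE sG0.
  by rewrite nth_default //; have := sG k.+1 isT; rewrite sG0 ltnS.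
move=> G'm G's; exists G', H'; split=> //; last by rewrite sG0.
by apply: swap_inj; rewrite rmorphM /= GE HE.
Qed.

End HenselCor.

(** * Puiseux series *)

Section Dilation.
Variable R : comNzRingType.
Implicit Types (f g : ser R).

(** The substitution of s^(m+1) for s, a ring morphism for every m. *)
Definition dil m f : ser R :=
  Ser (fun k => if (m.+1 %| k)%N then sc f (k %/ m.+1) else 0).

Lemma sc_dil m f k :
  sc (dil m f) k = if (m.+1 %| k)%N then sc f (k %/ m.+1) else 0.
Proof. by []. Qed.

Lemma sc_dilM m f k : sc (dil m f) (k * m.+1) = sc f k.
Proof. by rewrite sc_dil dvdn_mull // mulnK. Qed.

Lemma dil_zmod_morphism m : zmod_morphism (dil m).
Proof.
by move=> f g; apply: serP => k; rewrite scB !sc_dil; case: ifP; rewrite ?subr0.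
Qed.

Lemma dil_monoid_morphism m : monoid_morphism (dil m).
Proof.
split=> [|f g]; apply: serP => k; rewrite sc_dil.
  case: k => [|k] //=; rewrite !sc1; case: ifP => // /divnK.
  by case: (_ %/ _)%N.
have dc h l : (l <= k)%N ->
    (ser_trunc h k \Po 'X^(m.+1))`_l = sc (dil m h) l.
  move=> lk; rewrite coef_comp_poly_Xn // sc_dil; case: ifP => // _.
  by rewrite coef_ser_trunc // (leq_trans (leq_div _ _)).
rewrite -(coef_ser_mul (dc f) (dc g)) // -rmorphM /= coef_comp_poly_Xn //.
case: ifP => // mk.
have le l : (l <= k %/ m.+1)%N -> (l <= k)%N.
  by move=> lk; rewrite (leq_trans lk) // leq_div.
by rewrite (@coef_ser_mul _ _ _ f g (k %/ m.+1)) // => l lk; rewrite coef_ser_trunc ?le.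
Qed.

HB.instance Definition _ m :=
  GRing.isZmodMorphism.Build (ser R) (ser R) (dil m) (dil_zmod_morphism m).
HB.instance Definition _ m :=
  GRing.isMonoidMorphism.Build (ser R) (ser R) (dil m) (dil_monoid_morphism m).

Lemma dilD a b f : dil a (dil b f) = dil (a.+1 * b.+1).-1 f.
Proof.
apply: serP => k; rewrite !sc_dil prednK ?muln_gt0 //.
have [/dvdnP[l ->]|nd] := boolP (a.+1 %| k)%N; last first.
  by case: ifP => // /(dvdn_trans (dvdn_mulr _ (dvdnn _))); rewrite (negPf nd).
by rewrite mulnK // [(l * _)%N]mulnC dvdn_pmul2l // divnMl.
Qed.

Lemma map_dilD a b (P : {poly ser R}) :
  map_poly (dil a) (map_poly (dil b) P) = map_poly (dil (a.+1 * b.+1).-1) P.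
Proof. by apply/polyP => i; rewrite !coef_map /= dilD. Qed.

End Dilation.

Lemma size_sum_leq (R : nzRingType) (I : finType) (F : I -> {poly R}) n :
  (forall i, (size (F i) <= n)%N) -> (size (\sum_i F i)%R <= n)%N.
Proof.
move=> Fn; apply: leq_trans (size_sum _ _ _) _.
by apply/bigmax_leqP => i _.
Qed.

Lemma coef_exp_XsubC (R : comNzRingType) (b : R) e :
  (('X - b%:P) ^+ e.+1)`_e = - (b *+ e.+1).
Proof.
have := @coefPn_prod_XsubC _ (nseq e.+1 b).
by rewrite size_nseq !big_nseq iter_mulr_1 iter_addr_0; apply.
Qed.

(** Without subleading coefficient, a polynomial other than a power of T has at
    least two distinct roots in characteristic zero. *)
Lemma tschirnhaus (R : comNzRingType) (P : {poly R}) d (a : R) :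
  P \is monic -> size P = d.+2 -> a *+ d.+1 = 1 ->
  exists b : R, let P1 := P \Po ('X - b%:P) in
    [/\ (size P1 <= d.+2)%N, P1`_d.+1 = 1 & P1`_d = 0].
Proof.
move=> Pm sP ad; exists (P`_d * a) => P1.
have P1E : P1 = \sum_(i < d.+2) P`_i *: ('X - (P`_d * a)%:P) ^+ i.
  by rewrite /P1 comp_polyE sP.
have lc e : (('X - (P`_d * a)%:P) ^+ e)`_e = 1.
  have := monicP (monic_exp e (monicXsubC (P`_d * a))).
  by rewrite lead_coefE size_exp_XsubC.
have Pd : P`_d.+1 = 1 by have := monicP Pm; rewrite lead_coefE sP.
split.
- rewrite P1E; apply: size_sum_leq => i.
  apply: leq_trans (size_scale_leq _ _) _.
  by rewrite size_exp_XsubC.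
- rewrite P1E big_ord_recr /= coefD coefZ lc Pd mulr1.
  rewrite nth_default ?add0r //; apply: size_sum_leq => i.
  apply: leq_trans (size_scale_leq _ _) _.
  by rewrite size_exp_XsubC.
- rewrite P1E !big_ord_recr /= !coefD !coefZ lc Pd mul1r coef_exp_XsubC.
  rewrite nth_default ?add0r; last first.
    apply: size_sum_leq => i.
    apply: leq_trans (size_scale_leq _ _) _.
    by rewrite size_exp_XsubC.
  by rewrite -mulrnAr ad !mulr1 subrr.
Qed.

Section Puiseux.
Variable K : closedFieldType.
Hypothesis charK0 : [pchar K] =i pred0.
Notation S := (ser K).

Lemma natrK_neq0 n : (n.+1)%:R != 0 :> K.
Proof. by have /pcharf0P -> := charK0. Qed.

Lemma dil0 (f : S) : dil 0 f = f.
Proof. by apply: serP => k; rewrite sc_dil dvd1n divn1. Qed.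

Lemma map_dil0 (P : {poly S}) : map_poly (dil 0) P = P.
Proof. by apply/polyP => i; rewrite coef_map /= dil0. Qed.

(** The edge of the Newton polygon at its leading vertex.  With v_j the order of
    the coefficient P_j, it realizes the least slope v_j / (d - j); these slopes
    become integers after multiplication by d!. *)
Lemma newton_slope d (P : {poly S}) :
  (exists2 i, (i < d)%N & P`_i != 0) ->
  exists q p i0, [/\ (i0 < d)%N, q.+1 = (d - i0)%N, sc P`_i0 p != 0 &
    forall j, (j < d)%N -> eqmod (p * (d - j)) (dil q P`_j) 0].
Proof.
move=> [i id Pi].
have [v vP] : exists v : nat -> nat,
    forall j, P`_j != 0 -> has_order (v j) P`_j.
  have H j : exists n, P`_j != 0 -> has_order n P`_j.
    case: (eqVneq P`_j 0) => [->|/ex_has_order[n nP]]; last by exists n.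
    by exists 0%N.
  by exists (fun j => projT1 (cid (H j))) => j; exact: (projT2 (cid (H j))).
pose c (j : 'I_d) := (v j * (d`! %/ (d - j)))%N.
case: (@arg_minnP _ (Ordinal id) (fun j : 'I_d => P`_j != 0) c Pi).
move=> i0 Pi0 min0; have i0d := ltn_ord i0.
exists (d - i0).-1, (v i0), i0; split=> //.
- by rewrite prednK // subn_gt0.
- by case: (vP _ Pi0).
have qE : (d - i0).-1.+1 = (d - i0)%N by rewrite prednK // subn_gt0.
move=> j jd k kp; rewrite sc_dil sc0 qE; case: ifP => // /dvdnP[l kE].
case: (eqVneq P`_j 0) => [->|Pj]; first by rewrite sc0.
rewrite kE mulnK ?subn_gt0 //; case: (vP _ Pj) => H _; rewrite H ?sc0 //.
have := min0 (Ordinal jd) Pj; rewrite /c /=.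
have dv e : (e < d)%N -> (d`! %/ (d - e) * (d - e))%N = d`!.
  by move=> ed; rewrite divnK // dvdn_fact // subn_gt0 ed leq_subr.
rewrite -(leq_pmul2r (_ : 0 < (d - i0) * (d - j))%N); last first.
  by rewrite muln_gt0 !subn_gt0 i0d jd.
rewrite [X in (X <= _)%N](_ : _ = v i0 * (d - j) * d`!)%N; last first.
  have := dv i0 i0d; move: (d - i0)%N (d - j)%N (divn _ _) => a b e <-; ring.
rewrite [X in (_ <= X)%N](_ : _ = v j * (d - i0) * d`!)%N; last first.
  have := dv j jd; move: (d - i0)%N (d - j)%N (divn _ _) => a b e <-; ring.
rewrite leq_pmul2r ?fact_gt0 // => le.
rewrite -(ltn_pmul2r (_ : 0 < d - i0)%N) ?subn_gt0 // -kE.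
exact: leq_trans kp le.
Qed.

(** In Tschirnhaus form and rescaled along the edge of its Newton polygon, P
    reduces modulo s to a polynomial which is not a power of a linear one.
    Hensel's lemma splits off a proper factor, and the degree drops. *)
Lemma puiseux_root n (P : {poly S}) : P \is monic -> size P = n.+2 ->
  exists m r, root (map_poly (dil m) P) r.
Proof.
have [N] := ubnP n; elim: N n P => // N IH d P dN Pm sP.
have [|b [sP1 P1d P1d0]] := tschirnhaus (a := ser_const (d.+1%:R^-1)) Pm sP.
  by rewrite -rmorphMn -mulr_natr mulVf ?natrK_neq0 ?rmorph1.
set P1 := P \Po _ in sP1 P1d P1d0.
suff [m [r rP]] : exists m r, root (map_poly (dil m) P1) r.
  exists m, (r - dil m b); move: rP.
  rewrite /P1 map_comp_poly /root horner_comp rmorphB /= map_polyX map_polyC /=.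
  by rewrite hornerXsubC.
have [[i id Pi]|all0] := pselect (exists2 i, (i < d.+1)%N & P1`_i != 0); last first.
  exists 0%N, 0; rewrite map_dil0 /root.
  rewrite horner_coef0 -/(_ == 0); apply: contrapT => /negP P10.
  by apply: all0; exists 0%N.
have [q [p [i0 [i0d qE Pi0 slope]]]] := newton_slope (ex_intro2 _ _ i id Pi).
have P1gt j : (d.+1 < j)%N -> P1`_j = 0.
  by move=> dj; rewrite nth_default // (leq_trans sP1).
(* P2(s, T) = s^(-p (d + 1)) P1(s^(q + 1), s^p T), where P1 has degree d + 1. *)
pose b_ j : S := Ser (fun k => sc (dil q P1`_j) (k + p * (d.+1 - j))).
have bE j : (j <= d.+1)%N -> svar K ^+ (p * (d.+1 - j)) * b_ j = dil q P1`_j.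
  move=> jd; apply: serP => k; rewrite sc_svarXM.
  case: ltnP => [kp|pk]; last by rewrite /b_ {1}/sc subnK.
  move: jd; rewrite leq_eqVlt => /predU1P[jE|jd].
    by rewrite jE subnn muln0 in kp.
  by rewrite slope.
pose P2 : {poly S} := \poly_(j < d.+2) b_ j.
have [m [r rP2]] : exists m r, root (map_poly (dil m) P2) r; last first.
  exists (m.+1 * q.+1).-1, (dil m (svar K ^+ p) * r).
  rewrite -map_dilD /root.
  have sz (Q : {poly S}) a : (size Q <= d.+2)%N -> (size (map_poly (dil a) Q) <= d.+2)%N.
    by apply: leq_trans; apply: size_poly.
  rewrite (horner_coef_wide _ (sz _ m (sz _ q sP1))).
  move: rP2; rewrite /root (horner_coef_wide _ (sz _ m (size_poly _ _))).
  set t := dil m (svar K ^+ p) => /eqP rP2.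
  rewrite (_ : \sum_(_ < _) _ =
     t ^+ d.+1 * \sum_(j < d.+2) (map_poly (dil m) P2)`_j * r ^+ j).
    by rewrite rP2 mulr0.
  rewrite big_distrr; apply: eq_bigr => -[j /= jd] _.
  rewrite !coef_map /= coef_poly jd -bE // rmorphM /= exprM rmorphXn /= -/t.
  rewrite -{2}(subnK (_ : j <= d.+1)%N) // exprD exprMn; ring.
have P2d : P2`_d.+1 = 1.
  rewrite coef_poly ltnSn; have := bE d.+1 (leqnn _).
  by rewrite subnn muln0 mul1r P1d rmorph1.
have [P2m sP2] := monic_sizeP (size_poly _ _) P2d.
set p2 := map_poly (coef_ser 0) P2.
have p2E j : p2`_j = sc P2`_j 0 by rewrite coef_map_id0 ?raddf0.
have sp2 : (size p2 <= d.+2)%N by apply: leq_trans (size_poly _ _) _; rewrite sP2.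
have p2d1 : p2`_d.+1 = 1 by rewrite p2E P2d sc1.
have sp2E : size p2 = d.+2.
  apply/eqP; rewrite eqn_leq sp2 ltnNge /=; apply/negP => /leq_sizeP /(_ _ (leqnn _)).
  by rewrite p2d1 => /eqP; rewrite oner_eq0.
have p2m : p2 \is monic by rewrite monicE lead_coefE sp2E p2d1.
have p2d : p2`_d = 0.
  by rewrite p2E coef_poly ltnS leqnSn {1}/sc /= P1d0 rmorph0 sc0.
have p2i0 : p2`_i0 != 0.
  rewrite p2E coef_poly ltnS (ltnW i0d) {1}/sc /= add0n -qE mulnC.
  by rewrite mulnC sc_dilM.
have [c rc] : exists c, root p2 c by apply/closed_rootP; rewrite sp2E.
have [e [h0 hc p2h]] := multiplicity_XsubC p2 c.
rewrite monic_neq0 //= in hc.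
have h0n : h0 != 0 by apply: contraNneq hc => ->; rewrite root0.
have sh0 : (0 < size h0)%N by rewrite size_poly_gt0.
have e0 : (0 < e)%N.
  by case: e p2h => // p2h; move: rc; rewrite p2h mulr1 (negPf hc).
have sE : (size h0 + e = d.+2)%N.
  rewrite -sp2E p2h size_Mmonic ?monic_exp ?monicXsubC // size_exp_XsubC.
  by rewrite addnS.
have ed : (e < d.+1)%N.
  have : (e <= d.+1)%N by rewrite -ltnS -sE -[in X in (X <= _)%N]add1n leq_add2r.
  rewrite leq_eqVlt => /predU1P[eE|//].
  have /size_poly1P[u u0 h0E] : size h0 == 1%N.
    by rewrite -(eqn_add2r e) sE eE.
  have lc1 : lead_coef (('X - c%:P) ^+ d.+1) = 1.
    by apply/monicP; rewrite monic_exp ?monicXsubC.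
  have u1 : u = 1.
    have := monicP p2m; rewrite p2h h0E eE lead_coef_Mmonic ?monic_exp ?monicXsubC //.
    by rewrite lead_coefC.
  move: p2d p2i0; rewrite p2h h0E eE u1 mul1r coef_exp_XsubC => /eqP.
  rewrite oppr_eq0 -mulr_natr mulf_eq0 (negPf (natrK_neq0 _)) orbF => /eqP ->.
  by rewrite subr0 coefXn ltn_eqF // eqxx.
have [|||G [H [P2E Gm sG]]] := @hensel_poly K P2 (('X - c%:P) ^+ e) h0 P2m.
- by rewrite mulrC -p2h.
- by rewrite monic_exp ?monicXsubC.
- by apply: coprimep_expl; rewrite coprimep_sym coprimep_XsubC.
have [||m [r rG]] := IH e.-1 G _ Gm.
- by rewrite prednK //; exact: leq_trans (ltnSE ed) (ltnSE dN).
- by rewrite sG size_exp_XsubC prednK.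
by exists m, r; rewrite P2E rmorphM /= rootM rG.
Qed.

Lemma puiseux_split n (P : {poly S}) : P \is monic -> size P = n.+1 ->
  exists m (rs : seq S), map_poly (dil m) P = \prod_(r <- rs) ('X - r%:P).
Proof.
elim: n P => [|n IH] P Pm sP.
  exists 0%N, [::]; rewrite map_dil0 big_nil.
  have /size_poly1P[c c0 PE] : size P == 1%N by rewrite sP.
  by have := monicP Pm; rewrite PE lead_coefC => ->.
have [m [r /factor_theorem[Q QE]]] := puiseux_root Pm sP.
have Pm' : map_poly (dil m) P \is monic by rewrite monic_map.
have sP' : size (map_poly (dil m) P) = n.+2.
  rewrite size_map_poly_id0 ?sP //= (monicP Pm) rmorph1.
  exact: oner_neq0.
have Qm : Q \is monic by rewrite -(monicMr _ (monicXsubC r)) -QE.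
have sQ : size Q = n.+1.
  by move: sP'; rewrite QE size_Mmonic ?monicXsubC ?monic_neq0 // size_XsubC addn2 => -[].
have [m' [rs QrE]] := IH Q Qm sQ.
exists (m'.+1 * m.+1).-1, (dil m' r :: rs).
rewrite -map_dilD QE rmorphM /= QrE big_cons mulrC.
by rewrite rmorphB /= map_polyX map_polyC.
Qed.

Lemma puiseux_split_family n (P : 'I_n -> {poly S}) :
  (forall j, P j \is monic) ->
  exists m (rs : 'I_n -> seq S),
    forall j, map_poly (dil m) (P j) = \prod_(r <- rs j) ('X - r%:P).
Proof.
elim: n P => [|n IH] P Pm; first by exists 0%N, (fun=> [::]) => -[].
have [m [rs rsE]] := IH (fun j => P (lift ord0 j)) (fun j => Pm _).
have [e sP] : exists e, size (P ord0) = e.+1.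
  by exists (size (P ord0)).-1; rewrite prednK // size_poly_gt0 monic_neq0.
have [m' [r0 r0E]] := puiseux_split (Pm ord0) sP.
exists (m.+1 * m'.+1).-1, (fun j => if unlift ord0 j is Some k
  then map (dil m') (rs k) else map (dil m) r0) => j.
have mapE a (s : seq S) : map_poly (dil a) (\prod_(r <- s) ('X - r%:P)) =
    \prod_(r <- map (dil a) s) ('X - r%:P).
  by rewrite map_prod_XsubC big_map.
case: unliftP => [k ->|->]; last by rewrite -map_dilD r0E mapE.
by rewrite mulnC -map_dilD rsE mapE.
Qed.

End Puiseux.

(** * Clusters of roots *)

Section EqmodPoly.
Variable R : comNzRingType.
Implicit Types (p q : {poly ser R}).

Lemma eqmod_sum N (I : Type) (r : seq I) (F G : I -> ser R) :
  (forall i, eqmod N (F i) (G i)) ->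
  eqmod N (\sum_(i <- r) F i) (\sum_(i <- r) G i).
Proof.
move=> FG k kN; rewrite !sc_sum; apply: eq_bigr => i _; exact: FG.
Qed.

Lemma eqmod_swapP N p q :
  eqmod N (swap p) (swap q) <-> (forall i, eqmod N p`_i q`_i).
Proof.
split=> [H i k kN|H k kN]; first by rewrite -!coef_swap H.
by apply/polyP => i; rewrite !coef_swap H.
Qed.

Lemma eqmod_horner N p q x : eqmod N (swap p) (swap q) -> eqmod N p.[x] q.[x].
Proof.
move/eqmod_swapP => H; pose n := maxn (size p) (size q).
rewrite (@horner_coef_wide _ n p) ?leq_maxl // (@horner_coef_wide _ n q) ?leq_maxr //.
by apply: eqmod_sum => i; apply: eqmodM.
Qed.

Lemma eqmod_dil N m (f g : ser R) :
  eqmod N f g -> eqmod (N * m.+1) (dil m f) (dil m g).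
Proof.
move=> fg k kN; rewrite !sc_dil; case: ifP => // /divnK kE.
by apply: fg; rewrite -(ltn_pmul2r (ltn0Sn m)) kE.
Qed.

Lemma eqmod_map_dil N m p q : eqmod N (swap p) (swap q) ->
  eqmod (N * m.+1) (swap (map_poly (dil m) p)) (swap (map_poly (dil m) q)).
Proof.
move/eqmod_swapP => H; apply/eqmod_swapP => i; rewrite !coef_map.
exact: eqmod_dil.
Qed.

End EqmodPoly.

Section Near.
Variable R : comNzRingType.
Notation S := (ser R).
Implicit Types (f g h : S).

Definition near_ser k (f g : S) : bool :=
  all (fun l => sc f l == sc g l) (iota 0 k).

Arguments near_ser k%_N f%_R g%_R.

Lemma near_serP k f g : reflect (eqmod k f g) (near_ser k f g).
Proof.
apply: (iffP allP) => [H l lk|H l]; first by apply/eqP/H; rewrite mem_iota.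
by rewrite mem_iota => /= lk; apply/eqP/H.
Qed.

Lemma near_ser_sym k f g : near_ser k f g = near_ser k g f.
Proof. by apply/near_serP/near_serP => H l lk; rewrite H. Qed.

Lemma near_ser_eql k f g h : near_ser k f g -> near_ser k f h = near_ser k g h.
Proof.
by move/near_serP => fg; apply/near_serP/near_serP => H l lk; rewrite -H ?fg.
Qed.

End Near.
Arguments near_ser {R} k%_N f%_R g%_R.

Section Clusters.
Variable K : closedFieldType.
Notation S := (ser K).

(** The minimum of k and the order of f. *)
Definition cap_order k (f : S) := find (fun l => sc f l != 0) (iota 0 k).

Arguments cap_order k%_N f%_R.

Lemma cap_orderS k f :
  cap_order k.+1 f = (cap_order k f + near_ser k.+1 f 0%R)%N.
Proof.
rewrite /cap_order /near_ser -addn1 iotaD find_cat all_cat /= add0n sc0.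
rewrite (eq_all (a2 := predC (fun l => sc f l != 0))); last first.
  by move=> l /=; rewrite sc0 negbK.
rewrite all_predC; case: ifP => hs /=; first by rewrite addn0.
rewrite andbT hasNfind ?hs // size_iota; congr (_ + _)%N.
by case: eqP.
Qed.

(** The condition is that c is generic: then s^k c cancels no term of f. *)
Lemma has_cap_order k (f : S) c :
  c + sc f k != 0 -> has_order (cap_order k f) (f + svar K ^+ k * ser_const c).
Proof.
move=> cf; have le : (cap_order k f <= k)%N.
  by rewrite -[X in (_ <= X)%N](size_iota 0 k) find_size.
have lt0 l : (l < cap_order k f)%N -> sc f l = 0.
  move=> lk; have := before_find 0%N lk; rewrite nth_iota ?add0n.
    by move/negbFE/eqP.
  exact: leq_trans lk le.
split=> [l lk|].
  by rewrite scD sc_svarXM (leq_trans lk le) addr0 lt0 ?sc0.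
rewrite scD sc_svarXM; move: le; rewrite leq_eqVlt => /predU1P[->|lt].
  by rewrite ltnn subnn sc_const addrC.
rewrite lt addr0; have := @nth_find _ 0%N (fun l => sc f l != 0) (iota 0 k).
rewrite -/(cap_order k f) nth_iota // add0n; apply.
by rewrite has_find size_iota.
Qed.

(** Both sides are the orders of the two products at the same point, a generic
    point at distance k from r. *)
Lemma sum_cap_order N k (A B : seq S) r :
  size A = size B -> (k * size A < N)%N ->
  eqmod N (swap (\prod_(a <- A) ('X - a%:P))) (swap (\prod_(b <- B) ('X - b%:P))) ->
  (\sum_(a <- A) cap_order k (r - a) = \sum_(b <- B) cap_order k (r - b))%N.
Proof.
move=> sAB kN AB.
pose bad := \prod_(a <- A ++ B) ('X - (- sc (r - a) k)%:P).
have [|c] := closed_nonrootP bad _.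
  exact: monic_neq0 (monic_prod_XsubC _ _ _).
have -> : bad = \prod_(y <- map (fun a => - sc (r - a) k) (A ++ B)) ('X - y%:P).
  by rewrite big_map.
rewrite root_prod_XsubC => /mapP cbad.
pose x := r + svar K ^+ k * ser_const c.
have ordC (C : seq S) : {subset C <= A ++ B} ->
    has_order (\sum_(a <- C) cap_order k (r - a))%N (\prod_(a <- C) ('X - a%:P)).[x].
  move=> CAB; rewrite horner_prod big_seq [X in has_order _ X]big_seq.
  elim/big_ind2: _ => [|m f n g|a aC]; first exact: has_order1.
    exact: has_orderM.
  rewrite hornerXsubC /x addrAC; apply: has_cap_order; rewrite addr_eq0.
  by apply/eqP => E; apply: cbad; exists a => //; apply: CAB.
have leC (C : seq S) : (\sum_(a <- C) cap_order k (r - a) <= k * size C)%N.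
  elim: C => [|a C IH]; first by rewrite big_nil.
  rewrite big_cons /= mulnS leq_add //.
  by rewrite -[X in (_ <= X)%N](size_iota 0 k) find_size.
have subA : {subset A <= A ++ B} by move=> a; rewrite mem_cat => ->.
have subB : {subset B <= A ++ B} by move=> a; rewrite mem_cat orbC => ->.
apply: has_order_uniq (ordC _ subB).
apply: has_order_eqmod (eqmod_horner x AB) _ (ordC _ subA).
exact: leq_ltn_trans (leC _) kN.
Qed.

(** A root at distance at least k + 1 from r adds one to the sum of the capped
    orders when the cap passes from k to k + 1, and no other root does. *)
Lemma cluster_count N k (A B : seq S) r :
  size A = size B -> (k.+1 * size A < N)%N ->
  eqmod N (swap (\prod_(a <- A) ('X - a%:P))) (swap (\prod_(b <- B) ('X - b%:P))) ->
  count (near_ser k.+1 r) A = count (near_ser k.+1 r) B.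
Proof.
move=> sAB kN AB.
have kN' : (k * size A < N)%N by apply: leq_ltn_trans kN; rewrite leq_mul2r leqnSn orbT.
have cE (C : seq S) : (count (near_ser k.+1 r) C + \sum_(a <- C) cap_order k (r - a) =
    \sum_(a <- C) cap_order k.+1 (r - a))%N.
  elim: C => [|a C IH]; first by rewrite !big_nil.
  rewrite !big_cons /= -IH cap_orderS.
  have -> : near_ser k.+1 (r - a) 0 = near_ser k.+1 r a.
    apply/near_serP/near_serP => H l lk.
      by apply/eqP; rewrite -subr_eq0 -scB H.
    by rewrite scB H // subrr sc0.
  by rewrite addnACA [(near_ser _ _ _ + _)%N]addnC.
have := sum_cap_order r sAB kN AB.
have := sum_cap_order r sAB kN' AB.
by rewrite -!cE => -> /eqP; rewrite eqn_add2r => /eqP.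
Qed.

(** Replacing each root by a point that represents its cluster turns an
    approximate equality of products into an equality. *)
Lemma perm_cluster N k (A B : seq S) (m : S -> S) :
  size A = size B -> (k.+1 * size A < N)%N ->
  eqmod N (swap (\prod_(a <- A) ('X - a%:P))) (swap (\prod_(b <- B) ('X - b%:P))) ->
  (forall a b, near_ser k.+1 a b -> m a = m b) ->
  (forall a, a \in A ++ B -> near_ser k.+1 a (m a)) ->
  perm_eq (map m A) (map m B).
Proof.
move=> sAB kN AB mcong mnear.
have mE r a : r \in A ++ B -> a \in A ++ B -> (m a == m r) = near_ser k.+1 r a.
  move=> rAB aAB; apply/eqP/idP => [E|/mcong //].
  rewrite (near_ser_eql _ (mnear r rAB)) -E near_ser_sym; exact: mnear.
apply/allP => x; rewrite -map_cat => /mapP[r rAB ->] /=; rewrite !count_map.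
rewrite (eq_in_count (a2 := near_ser k.+1 r)); last first.
  by move=> a aA /=; rewrite mE // mem_cat aA.
rewrite [X in _ == X](eq_in_count (a2 := near_ser k.+1 r)); last first.
  by move=> a aB /=; rewrite mE // mem_cat aB orbT.
by apply/eqP; exact: cluster_count AB.
Qed.

End Clusters.

Section Rotation.
Variables (K : fieldType) (z : K).

(** The substitution of z s for s; for z a primitive root of unity it generates
    the Galois group of the series in s over those in a power of s. *)
Definition twist (f : ser K) : ser K := Ser (fun k => z ^+ k * sc f k).

Lemma sc_twist f k : sc (twist f) k = z ^+ k * sc f k. Proof. by []. Qed.

Lemma twist_zmod_morphism : zmod_morphism twist.
Proof. by move=> f g; apply: serP => k; rewrite scB !sc_twist scB mulrBr. Qed.

Lemma twist_monoid_morphism : monoid_morphism twist.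
Proof.
split=> [|f g]; apply: serP => k; rewrite sc_twist.
  by rewrite sc1; case: k => [|k]; rewrite ?mulr0 ?mulr1.
rewrite !scM big_distrr; apply: eq_bigr => -[l /= lk] _.
by rewrite !sc_twist -{1}(subnKC (ltnSE lk)) exprD; ring.
Qed.

HB.instance Definition _ :=
  GRing.isZmodMorphism.Build (ser K) (ser K) twist twist_zmod_morphism.
HB.instance Definition _ :=
  GRing.isMonoidMorphism.Build (ser K) (ser K) twist twist_monoid_morphism.

Lemma twist_const c : twist (ser_const c) = ser_const c.
Proof.
by apply: serP => k; rewrite sc_twist sc_const; case: k => [|k]; rewrite ?mulr0 ?mul1r.
Qed.

Lemma twist_dil m f : z ^+ m.+1 = 1 -> twist (dil m f) = dil m f.
Proof.
move=> z1; apply: serP => k; rewrite sc_twist sc_dil; case: ifP; rewrite ?mulr0 //.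
by move=> /dvdnP[l ->]; rewrite mulnC exprM z1 expr1n mul1r.
Qed.

(** The Galois descent from K[[s]] to K[[s^(m+1)]]. *)
Lemma twist_fix m f : m.+1.-primitive_root z -> twist f = f ->
  dil m (Ser (fun k => sc f (k * m.+1))) = f.
Proof.
move=> zp rf; apply: serP => k; rewrite sc_dil; case: ifP => mk.
  by rewrite /sc /= -/(sc f _) divnK.
apply/esym/eqP; move/(congr1 (coef_ser k)): rf => /eqP.
rewrite /coef_ser sc_twist -subr_eq0 -[X in _ - X]mul1r -mulrBl mulf_eq0.
by rewrite subr_eq0 -(prim_order_dvd zp) mk.
Qed.

Lemma near_twist k f g : z != 0 -> near_ser k (twist f) (twist g) = near_ser k f g.
Proof.
move=> z0; apply/near_serP/near_serP => H l lk; last by rewrite !sc_twist H.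
have := H l lk; rewrite !sc_twist; apply: mulfI; exact: expf_neq0.
Qed.

End Rotation.

Lemma ser_XsubC_perm (K : fieldType) (s t : seq (ser K)) :
  \prod_(x <- s) ('X - x%:P) = \prod_(x <- t) ('X - x%:P) -> perm_eq s t.
Proof.
move=> /(congr1 (map_poly (@tofrac (ser K)))); rewrite !map_prod_XsubC => E.
apply: (perm_map_inj (f := @tofrac (ser K))).
  by move=> x y /eqP; rewrite tofrac_eq => /eqP.
by apply: prod_XsubC_eq; rewrite !big_map.
Qed.

Lemma closed_prim_root (K : closedFieldType) m : [pchar K] =i pred0 ->
  exists z : K, m.+1.-primitive_root z.
Proof.
move=> charK0; have nz : (m.+1)%:R != 0 :> K by have /pcharf0P -> := charK0.
have [rs rsE] := closed_field_poly_normal ('X^(m.+1) - 1 : {poly K}).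
have lc : lead_coef ('X^(m.+1) - 1 : {poly K}) = 1.
  by apply/monicP; apply: monic_Xn_sub_1.
rewrite lc scale1r in rsE.
have sz : size rs = m.+1.
  by have := size_prod_XsubC rs id; rewrite -rsE size_Xn_sub_1 // => -[].
have ur : uniq rs.
  rewrite -separable_prod_XsubC -rsE; exact: separable_Xn_sub_1.
have /hasP[z _ zp] : has m.+1.-primitive_root rs.
  apply: has_prim_root => //; last by rewrite sz.
  apply/allP => z zr; rewrite unity_rootE; apply/eqP.
  have : root ('X^(m.+1) - 1 : {poly K}) z by rewrite rsE root_prod_XsubC.
  by rewrite /root !hornerE => /eqP /(congr1 (fun x => x + 1)); rewrite subrK add0r.
by exists z.
Qed.

(** * Monomial equations between monic polynomials *)

Section ToricPolys.
Variable K : closedFieldType.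
Hypothesis charK0 : [pchar K] =i pred0.
Notation S := (ser K).

Definition weight n (u d : 'I_n -> nat) : nat := (\sum_j u j * d j)%N.

Definition power n (R : comNzRingType) (x : 'I_n -> R) (u : 'I_n -> nat) : R :=
  \prod_j x j ^+ u j.

Definition cluster_mean (all : seq S) k (r : S) : S :=
  ser_const ((count (near_ser k r) all)%:R^-1) * \sum_(a <- all | near_ser k r a) a.

Lemma cluster_mean_congr all k r r' :
  near_ser k r r' -> cluster_mean all k r = cluster_mean all k r'.
Proof.
move=> rr'; have E := near_ser_eql _ rr'; rewrite /cluster_mean.
by rewrite (eq_count (E)) (eq_bigl _ _ (E)).
Qed.

Lemma near_cluster_mean all k r :
  r \in all -> near_ser k r (cluster_mean all k r).
Proof.
move=> rall; apply/near_serP => l lk; rewrite sc_constM sc_sum.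
set c := count _ _.
have c0 : c%:R != 0 :> K.
  have /pcharf0P -> := charK0; rewrite -lt0n -has_count; apply/hasP; exists r => //.
  exact/near_serP.
apply: (mulfI c0); rewrite mulrA divff // mul1r /c -sum1_count natr_sum mulr_suml.
by apply: eq_bigr => a /near_serP ->; rewrite ?mul1r.
Qed.

Lemma twist_cluster_mean (z : K) all k r : z != 0 -> perm_eq (map (twist z) all) all ->
  twist z (cluster_mean all k r) = cluster_mean all k (twist z r).
Proof.
move=> z0 pall; rewrite /cluster_mean rmorphM /= twist_const rmorph_sum /=.
have <- : count (near_ser k r) all = count (near_ser k (twist z r)) all.
  rewrite -[RHS](permP pall) count_map; apply: eq_count => a /=.
  by rewrite near_twist.
congr (_ * _); rewrite -[RHS](perm_big _ pall) big_map; apply: eq_bigl => a.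
by rewrite near_twist.
Qed.

(** The roots of the P_j are Puiseux series, in s^(1/M) say.  An approximate
    monomial relation forces every cluster, that is every class of roots modulo
    a given power of s, to contain equally many roots of both sides.  Moving
    each root to the mean of its cluster makes the relation exact, and as means
    commute with the Galois group the new polynomials still have coefficients
    in K[[s]]. *)
Lemma toric_polys n (P : 'I_n -> {poly S}) (d : 'I_n -> nat)
    (E : ('I_n -> nat) -> ('I_n -> nat) -> Prop) i :
  (forall j, P j \is monic) -> (forall j, size (P j) = (d j).+1) ->
  (forall u v, E u v -> weight u d = weight v d /\
     exists2 N, (i.+1 * weight u d < N)%N &
       eqmod N (swap (power P u)) (swap (power P v))) ->
  exists Q : 'I_n -> {poly S},
    [/\ forall j, size (Q j) = (d j).+1,
        forall j, eqmod i.+1 (swap (Q j)) (swap (P j)) &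
        forall u v, E u v -> power Q u = power Q v].
Proof.
move=> Pm sP EP.
have [m [rs rsE]] := puiseux_split_family charK0 Pm.
have [z zp] := closed_prim_root m charK0.
have zM : z ^+ m.+1 = 1 by apply: prim_expr_order.
have z0 : z != 0.
  by apply: contraTneq (oner_neq0 K) => z0; rewrite -zM z0 exprS mul0r eqxx.
pose rall := flatten [seq rs j | j <- enum 'I_n].
have rallP j r : r \in rs j -> r \in rall.
  by move=> rj; apply/flatten_mapP; exists j => //; rewrite mem_enum.
have srs j : size (rs j) = d j.
  have := size_prod_XsubC (rs j) id; rewrite -rsE size_map_poly_id0 ?sP => [[]//|].
  by rewrite (monicP (Pm j)) rmorph1 oner_neq0.
have twist_rs j : perm_eq (map (twist z) (rs j)) (rs j).
  apply: ser_XsubC_perm; rewrite big_map -(map_prod_XsubC (twist z)) -rsE.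
  by apply/polyP => l; rewrite !coef_map /= twist_dil.
have twist_all : perm_eq (map (twist z) rall) rall.
  rewrite /rall map_flatten -map_comp; elim: (enum _) => //= j s IH.
  by rewrite perm_cat.
pose k := (i.+1 * m.+1).-1.
have kE : k.+1 = (i.+1 * m.+1)%N by [].
pose mean := cluster_mean rall k.+1.
have mean_cong a b : near_ser k.+1 a b -> mean a = mean b.
  exact: cluster_mean_congr.
have mean_near a : a \in rall -> near_ser k.+1 a (mean a).
  exact: near_cluster_mean.
have mean_twist a : twist z (mean a) = mean (twist z a) by apply: twist_cluster_mean.
pose Q j := \prod_(r <- rs j) ('X - (mean r)%:P).
pose Q' j := map_poly (fun f => Ser (fun l => sc f (l * m.+1))) (Q j).
have cQ' j l : (Q' j)`_l = Ser (fun a => sc (Q j)`_l (a * m.+1)).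
  by rewrite coef_map_id0 //; apply: serP.
have twistQ j : map_poly (twist z) (Q j) = Q j.
  rewrite map_prod_XsubC (eq_bigr (fun r => 'X - (mean (twist z r))%:P)); last first.
    by move=> r _; rewrite /= mean_twist.
  rewrite -(big_map (twist z) xpredT (fun r => 'X - (mean r)%:P)).
  exact: perm_big (twist_rs j).
have Q'E j : map_poly (dil m) (Q' j) = Q j.
  apply/polyP => l; rewrite coef_map cQ' /=; apply: (twist_fix zp).
  by rewrite -[in RHS]twistQ coef_map.
have sQ j : size (Q j) = (d j).+1 by rewrite size_prod_XsubC srs.
(* The multiset of roots of a monomial in the P_j. *)
pose W (u : 'I_n -> nat) := flatten [seq flatten (nseq (u j) (rs j)) | j <- enum 'I_n].
have WE (F : S -> {poly S}) u :
    \prod_(r <- W u) F r = power (fun j => \prod_(r <- rs j) F r) u.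
  rewrite /W big_flatten big_map big_enum; apply: eq_bigr => j _.
  by rewrite big_flatten big_nseq iter_mulr_1.
have sW u : size (W u) = weight u d.
  rewrite /W /weight -sum1_size big_flatten big_map big_enum.
  apply: eq_bigr => j _; rewrite big_flatten big_nseq iter_addn_0 sum1_size srs.
  exact: mulnC.
have Wall u : {subset W u <= rall}.
  move=> r /flatten_mapP[j _ /flattenP[s]]; rewrite mem_nseq => /andP[_ /eqP ->].
  exact: rallP.
have map_power u : map_poly (dil m) (power P u) = \prod_(r <- W u) ('X - r%:P).
  rewrite WE rmorph_prod; apply: eq_bigr => j _.
  by rewrite rmorphXn /= rsE.
exists Q'; split.
- move=> j; apply/eqP; rewrite -(sQ j) eqn_leq -[in X in _ && X]Q'E.
  by rewrite size_poly size_poly.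
- move=> j; apply/eqmod_swapP => l a ai; rewrite cQ'.
  change (sc (Q j)`_l (a * m.+1) = sc (P j)`_l a).
  have -> : sc (P j)`_l a = sc (map_poly (dil m) (P j))`_l (a * m.+1).
    by rewrite coef_map /= sc_dilM.
  rewrite rsE /Q; apply: (proj1 (eqmod_swapP k.+1 _ _)); last first.
    by rewrite kE ltn_pmul2r.
  have: {subset rs j <= rall} by move=> r; apply: rallP.
  elim: (rs j) => [|r s IH] sub; first by rewrite !big_nil.
  rewrite !big_cons !(rmorphM (@swap K)) /=; apply: eqmodM; last first.
    by apply: IH => b bs; apply: sub; rewrite inE bs orbT.
  apply/eqmod_swapP => b c ck; rewrite !coefB !coefC !scB; congr (_ - _).
  case: ifP => // _; have /near_serP H := mean_near r (sub r (mem_head _ _)).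
  by rewrite H.
- move=> u v Euv; have [wuv [N iN PN]] := EP u v Euv.
  have QE w : map_poly (dil m) (power Q' w) = power Q w.
    by rewrite rmorph_prod; apply: eq_bigr => j _; rewrite rmorphXn /= Q'E.
  have inj : injective (map_poly (@dil K m)).
    move=> p q pq; apply/polyP => l; apply: serP => a.
    by have := congr1 (fun p => sc (p : {poly S})`_l (a * m.+1)) pq; rewrite !coef_map /= !sc_dilM.
  apply: inj; rewrite !QE -!WE -!(big_map mean xpredT (fun r => 'X - r%:P)).
  apply: perm_big; apply: (@perm_cluster _ (N * m.+1) k) => //.
  + by rewrite !sW.
  + by rewrite sW kE mulnAC ltn_pmul2r.
  + by rewrite -!map_power; apply: eqmod_map_dil.
  + by move=> a; rewrite mem_cat => /orP[] /Wall /mean_near.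
Qed.

End ToricPolys.

(** * Monomial equations between units *)

Section Euler.
Variable R : comNzRingType.
Implicit Types (f g : ser R).

(** The derivation s d/ds. *)
Definition euler f : ser R := Ser (fun k => sc f k *+ k).

Lemma sc_euler f k : sc (euler f) k = sc f k *+ k. Proof. by []. Qed.

Lemma eulerM f g : euler (f * g) = euler f * g + f * euler g.
Proof.
apply: serP => k; rewrite sc_euler scD !scM -sumrMnl -big_split.
apply: eq_bigr => -[l /= lk] _; rewrite !sc_euler mulrnAl mulrnAr -mulrnDr.
by rewrite (subnKC (ltnSE lk)).
Qed.

Lemma euler_const c : euler (ser_const c) = 0.
Proof. by apply: serP => -[|k]; rewrite sc_euler sc_const ?mul0rn. Qed.

Lemma euler_power n (U th : 'I_n -> ser R) u :
  (forall j, euler (U j) = th j * U j) ->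
  euler (power U u) = (\sum_j th j *+ u j) * power U u.
Proof.
move=> UE; have UX j e : euler (U j ^+ e) = (th j *+ e) * U j ^+ e.
  elim: e => [|e IH]; first by rewrite expr0 euler_const mulr0n mul0r.
  by rewrite exprS eulerM UE IH mulrSr; ring.
rewrite /power; elim: (index_enum _) => [|j s IH].
  by rewrite !big_nil euler_const mul0r.
by rewrite !big_cons eulerM UX IH; ring.
Qed.
End Euler.

Section ToricUnits.
Variable K : fieldType.
Hypothesis charK0 : [pchar K] =i pred0.
Notation L := {poly K}.
Implicit Types (U V W th eta : ser L).

(** The degree bound that characterizes the blow-ups of series in (t, z). *)
Definition size_graded (f : ser L) := forall k, (size (sc f k) <= k.+1)%N.

Lemma size_polyM_graded (p q : L) a b k : (a + b <= k)%N ->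
  (size p <= a.+1)%N -> (size q <= b.+1)%N -> (size (p * q)%R <= k.+1)%N.
Proof. by move=> ab pa qb; apply: leq_trans (size_polyMleq _ _) _; lia. Qed.

(** The logarithmic derivative th turns products into sums; it plays the part of
    the logarithm of U. *)
Lemma log_euler U (c : K) : sc U 0 = c%:P -> c != 0 -> size_graded U ->
  exists th, [/\ euler U = th * U, sc th 0 = 0 & size_graded th].
Proof.
move=> U0 c0 sU.
pose step k (h : nat -> L) := c^-1 *: (sc U k *+ k - \sum_(l < k) h l * sc U (k - l)).
have [h hE] := strong_rec 0 step.
have {}hE k : h k = c^-1 *: (sc U k *+ k - \sum_(l < k) h l * sc U (k - l)).
  rewrite hE; congr (_ *: (_ - _)); apply: eq_bigr => -[l lk] _ /=.
  by rewrite lk.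
exists (Ser h); split; last 1 first.
- move=> k; rewrite /sc /=; have [m] := ubnP k; elim: m k => // m IH k km.
  rewrite hE; apply: leq_trans (size_scale_leq _ _) _.
  apply: leq_trans (size_polyD _ _) _; rewrite geq_max size_polyN -mulr_natr.
  apply/andP; split.
    apply: (@size_polyM_graded _ _ k 0); rewrite ?addn0 ?sU //.
    by rewrite -polyC_natr size_polyC leq_b1.
  apply: size_sum_leq => -[l /= lk].
  apply: (@size_polyM_graded _ _ l (k - l)); rewrite ?subnKC ?sU //; first exact: ltnW.
  by apply: IH; apply: leq_trans lk _.
- apply: serP => k; rewrite sc_euler scM big_ord_recr /= subnn U0.
  rewrite (hE k : sc (Ser h) k = _) -mul_polyC mulrAC -polyCM mulVf // mul1r.
  by rewrite addrC subrK.
by rewrite /sc /= hE mulr0n big_ord0 subr0 scaler0.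
Qed.

(** In characteristic zero V is recovered from its logarithmic derivative and its
    constant term. *)
Lemma exp_euler th (c : K) : sc th 0 = 0 -> size_graded th ->
  exists V, [/\ euler V = th * V, sc V 0 = c%:P & size_graded V].
Proof.
move=> th0 sth.
pose step k (h : nat -> L) :=
  if k == 0%N then c%:P else k%:R^-1 *: \sum_(l < k) sc th (k - l) * h l.
have [h hE] := strong_rec 0 step.
have {}hE k : h k = if k == 0%N then c%:P
    else k%:R^-1 *: \sum_(l < k) sc th (k - l) * h l.
  rewrite hE /step; case: ifP => // _; congr (_ *: _).
  by apply: eq_bigr => -[l lk] _ /=; rewrite lk.
exists (Ser h); split; last 1 first.
- move=> k; rewrite /sc /=; have [m] := ubnP k; elim: m k => // m IH k km.
  rewrite hE; case: eqP => [-> |_]; first by rewrite size_polyC leq_b1.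
  apply: leq_trans (size_scale_leq _ _) _; apply: size_sum_leq => -[l /= lk].
  apply: (@size_polyM_graded _ _ (k - l) l); rewrite ?subnK ?sth //; first exact: ltnW.
  by apply: IH; apply: leq_trans lk _.
- apply: serP => k; rewrite sc_euler scMr big_ord_recr /= subnn th0 mul0r addr0.
  rewrite (hE k : sc (Ser h) k = _); case: eqP => [->|/eqP k0]; first by rewrite mulr0n big_ord0.
  have kn : k%:R != 0 :> K by have /pcharf0P -> := charK0.
  rewrite -scaler_nat scalerA divff // scale1r; apply: eq_bigr => -[l lk] _ //.
by rewrite /sc /= hE.
Qed.

Lemma euler_eqmod N V W th eta :
  euler V = th * V -> euler W = eta * W -> sc th 0 = 0 -> sc eta 0 = 0 ->
  sc V 0 = sc W 0 -> eqmod N th eta -> eqmod N V W.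
Proof.
move=> VE WE th0 eta0 VW0 the k; have [m] := ubnP k.
elim: m k => // m IH [|k] km kN //.
have kn : (k.+1)%:R != 0 :> K by have /pcharf0P -> := charK0.
have : sc (euler V) k.+1 = sc (euler W) k.+1.
  rewrite VE WE !scMr big_ord_recr [in RHS]big_ord_recr /= !subnn th0 eta0 !mul0r !addr0.
  apply: eq_bigr => -[l /= lk] _; rewrite the ?IH //.
  - by rewrite (leq_trans lk).
  - by rewrite (ltn_trans lk).
  - by rewrite (leq_ltn_trans _ kN) // leq_subr.
rewrite !sc_euler -!scaler_nat => /(congr1 (fun p => k.+1%:R^-1 *: p)).
by rewrite !scalerA mulVf // !scale1r.
Qed.

Lemma log_euler_eqmod N V W th eta :
  euler V = th * V -> euler W = eta * W -> sc V 0 != 0 -> eqmod N V W ->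
  eqmod N th eta.
Proof.
move=> VE WE V0 VW k; have [m] := ubnP k; elim: m k => // m IH k km kN.
have : sc (th * V) k = sc (eta * W) k.
  by rewrite -VE -WE !sc_euler VW.
rewrite !scM !big_ord_recr /= !subnn -(VW 0%N); last exact: leq_trans kN.
have -> : \sum_(l < k) sc th l * sc V (k - l) = \sum_(l < k) sc eta l * sc W (k - l).
  apply: eq_bigr => -[l /= lk] _; rewrite VW ?IH //.
  - by rewrite (leq_trans lk).
  - by rewrite (ltn_trans lk).
  - by rewrite (leq_ltn_trans _ kN) // leq_subr.
by move/addrI; apply: mulIf.
Qed.

(** A monomial equation modulo s^N is a linear equation with integer coefficients
    modulo s^N between the logarithmic derivatives.  It becomes exact when these
    are truncated at s^N, and integration gives the corrected units. *)
Lemma toric_units n (U : 'I_n -> ser L) (lam : 'I_n -> K)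
    (E : K -> K -> ('I_n -> nat) -> ('I_n -> nat) -> Prop) N : (0 < N)%N ->
  (forall j, sc (U j) 0 = (lam j)%:P) -> (forall j, lam j != 0) ->
  (forall j, size_graded (U j)) ->
  (forall a b u v, E a b u v -> a != 0 /\
     eqmod N (ser_const a%:P * power U u) (ser_const b%:P * power U v)) ->
  exists V : 'I_n -> ser L,
    [/\ forall j, size_graded (V j), forall j, eqmod N (V j) (U j) &
        forall a b u v, E a b u v ->
          ser_const a%:P * power V u = ser_const b%:P * power V v].
Proof.
move=> N0 U0 lam0 sU EU.
have /choice[th thP] : forall j, exists th,
    [/\ euler (U j) = th * U j, sc th 0 = 0 & size_graded th].
  by move=> j; apply: log_euler (U0 j) (lam0 j) (sU j).
pose tr (f : ser L) : ser L := Ser (fun k => if (k < N)%N then sc f k else 0).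
have sc_tr f k : sc (tr f) k = if (k < N)%N then sc f k else 0 by [].
have tr0 j : sc (tr (th j)) 0 = 0 by rewrite sc_tr N0; case: (thP j).
have /choice[V VP] : forall j, exists V,
    [/\ euler V = tr (th j) * V, sc V 0 = (lam j)%:P & size_graded V].
  move=> j; apply: exp_euler => // k; rewrite sc_tr; case: ifP => _.
    by case: (thP j).
  by rewrite size_poly0.
have trE j : eqmod N (tr (th j)) (th j) by move=> k kN; rewrite sc_tr kN.
have VU j : eqmod N (V j) (U j).
  have [VE V0 _] := VP j; have [UE t0 _] := thP j.
  by apply: (euler_eqmod VE UE) => //; rewrite ?V0 ?U0.
exists V; split=> //; first by move=> j; case: (VP j).
move=> a b u v Eab; have [a0 EN] := EU _ _ _ _ Eab.
have cpow c (X t : 'I_n -> ser L) w : (forall j, euler (X j) = t j * X j) ->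
    euler (ser_const c%:P * power X w) =
    (\sum_j t j *+ w j) * (ser_const c%:P * power X w).
  by move=> XE; rewrite eulerM euler_const mul0r add0r (euler_power _ XE) mulrCA.
have UE j : euler (U j) = th j * U j by case: (thP j).
have VE j : euler (V j) = tr (th j) * V j by case: (VP j).
have pow0 (X : 'I_n -> ser L) w : (forall j, sc (X j) 0 = (lam j)%:P) ->
    sc (power X w) 0 = (\prod_j lam j ^+ w j)%:P.
  move=> X0; rewrite sc0_prod rmorph_prod; apply: eq_bigr => j _.
  by rewrite sc0X X0 rmorphXn.
have V0 j : sc (V j) 0 = (lam j)%:P by case: (VP j).
have thE : eqmod N (\sum_j th j *+ u j) (\sum_j th j *+ v j).
  apply: log_euler_eqmod (cpow a _ _ u UE) (cpow b _ _ v UE) _ EN.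
  rewrite scM0 sc_const pow0 // -polyCM polyC_eq0 mulf_neq0 //.
  by apply/prodf_neq0 => j _; rewrite expf_neq0.
have sumMn w k (t : 'I_n -> ser L) : sc (\sum_j t j *+ w j) k = \sum_j sc (t j) k *+ w j.
  by rewrite sc_sum; apply: eq_bigr => j _; exact: (raddfMn (coef_ser k)).
apply: serP => k; apply: (euler_eqmod (N := k.+1) (cpow a _ _ u VE) (cpow b _ _ v VE)) => //.
- by rewrite sumMn big1 // => j _; rewrite tr0 mul0rn.
- by rewrite sumMn big1 // => j _; rewrite tr0 mul0rn.
- rewrite !scM0 (pow0 _ u V0) (pow0 _ v V0) -(pow0 _ u U0) -(pow0 _ v U0) -!scM0.
  exact: EN.
move=> l _; rewrite !sumMn; case: (ltnP l N) => lN.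
  have := thE l lN; rewrite !sumMn => E'.
  by under eq_bigr do rewrite sc_tr lN; under [RHS]eq_bigr do rewrite sc_tr lN.
by rewrite !big1 // => j _; rewrite sc_tr ltnNge lN mul0rn.
Qed.

End ToricUnits.

(** * Blowing up the origin *)

Section Blowup.
Variables (K : fieldType) (c : K).
Implicit Types (f g : series2 K) (p q : {poly {poly K}}).

Let L : {poly K} := 1 + c *: 'X.

(** The pull-back of f(t, z) under t = s (1 + c T), z = s T, the chart of the
    blow-up of the origin in which the form of degree e is the coefficient of
    s^e.  For generic c the leading form of f has top degree in T. *)
Definition blowup f : ser {poly K} :=
  Ser (fun e => \sum_(i < e.+1) (scoef f i (e - i))%:P * (L ^+ i * 'X^(e - i))).

Lemma sc_blowup f e : sc (blowup f) e =
  \sum_(i < e.+1) (scoef f i (e - i))%:P * (L ^+ i * 'X^(e - i)).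
Proof. by []. Qed.

Lemma blowup_zmod_morphism : zmod_morphism blowup.
Proof.
move=> f g; apply: serP => e; rewrite scB !sc_blowup -sumrB.
by apply: eq_bigr => i _; rewrite -mulrBl -polyCB.
Qed.

(* On polynomials the blow-up is a substitution; as a coefficient of a product
   involves finitely many coefficients of the factors, this gives
   multiplicativity on series. *)
Let zs : {poly {poly K}} := ('X : {poly K})%:P * 'X.
Let ts : {poly {poly K}} := L%:P * 'X.
Let polyCC : {rmorphism K -> {poly {poly K}}} := polyC \o polyC.
Let subst_z : {rmorphism {poly K} -> {poly {poly K}}} :=
  horner_morph (f := polyCC) (u := zs) (fun x => mulrC zs (polyCC x)).
Let subst : {rmorphism {poly {poly K}} -> {poly {poly K}}} :=
  horner_morph (f := subst_z) (u := ts) (fun x => mulrC ts (subst_z x)).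

Lemma coef_subst_z (r : {poly K}) j : (subst_z r)`_j = r`_j *: 'X^j.
Proof.
have -> : subst_z r = (map_poly polyCC r).[zs] by [].
rewrite (horner_coef_wide _ (size_poly _ _)) coef_sum.
under eq_bigr => i _ do
  rewrite coef_map /= exprMn mulrA -rmorphXn -polyCM coefCM coefXn.
case: (ltnP j (size r)) => jr; last first.
  rewrite nth_default // scale0r big1 // => -[i /= ir] _.
  by rewrite gtn_eqF ?mulr0 // (leq_trans ir).
rewrite (bigD1 (Ordinal jr)) //= eqxx mulr1 big1 ?addr0 ?mul_polyC //.
move=> i /eqP ij; case: eqP => [E|]; last by rewrite mulr0.
by case: ij; apply: val_inj.
Qed.

Lemma coef_subst p e :
  (subst p)`_e = \sum_(i < e.+1) (p`_i`_(e - i))%:P * (L ^+ i * 'X^(e - i)).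
Proof.
have -> : subst p = (map_poly subst_z p).[ts] by [].
rewrite (@horner_coef_wide _ (maxn (size p) e.+1)); last first.
  by apply: leq_trans (size_poly _ _) (leq_maxl _ _).
rewrite coef_sum (big_ord_widen (maxn (size p) e.+1)
  (fun i => (p`_i`_(e - i))%:P * (L ^+ i * 'X^(e - i)))) ?leq_maxr //.
rewrite [RHS]big_mkcond; apply: eq_bigr => i _; rewrite coef_map.
rewrite /ts exprMn (mulrA (subst_z _)) -polyC_exp coefMXn ltnS ltnNge; case: leqP => //= ie.
by rewrite coefMC coef_subst_z -mul_polyC -mulrA [_ * L ^+ i]mulrC.
Qed.

Lemma coef_subst_agree p f n e : agree p f n n -> (e <= n)%N ->
  (subst p)`_e = sc (blowup f) e.
Proof.
move=> pf en; rewrite coef_subst; apply: eq_bigr => -[i /= ie] _.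
by rewrite pf // (leq_trans _ en) // ?leq_subr.
Qed.

Lemma blowup_monoid_morphism : monoid_morphism blowup.
Proof.
split=> [|f g]; apply: serP => e.
  rewrite sc_blowup sc1 big_ord_recl big1 /= ?addr0 => [|i _]; last by rewrite mul0r.
  by case: e => [|e]; rewrite ?mul0r // subn0 !expr0 !mulr1.
have F := @agree_trunc _ f e e; have G := @agree_trunc _ g e e.
rewrite -(coef_subst_agree (agree_mul F G)) // rmorphM coefM scM.
apply: eq_bigr => -[k /= ke] _; rewrite (coef_subst_agree F) //.
by rewrite (coef_subst_agree G) // leq_subr.
Qed.

HB.instance Definition _ :=
  GRing.isZmodMorphism.Build (series2 K) (ser {poly K}) blowup blowup_zmod_morphism.
HB.instance Definition _ :=
  GRing.isMonoidMorphism.Build (series2 K) (ser {poly K}) blowup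
    blowup_monoid_morphism.

Lemma blowup_const a : blowup (sconst a) = ser_const a%:P.
Proof.
apply: serP => e; rewrite sc_blowup sc_const big_ord_recl big1 /= => [|i _]; last by rewrite mul0r.
by case: e => [|e]; rewrite ?mul0r addr0 // subn0 !expr0 !mulr1.
Qed.

Lemma size_Lexp i : (size (L ^+ i) <= i.+1)%N.
Proof.
elim: i => [|i IH]; first by rewrite expr0 size_poly1.
rewrite exprS; apply: leq_trans (size_polyMleq _ _) _.
have : (size L <= 2)%N.
  apply: leq_trans (size_polyD _ _) _; rewrite size_poly1 geq_max /=.
  by apply: leq_trans (size_scale_leq _ _) _; rewrite size_polyX.
by move: IH; lia.
Qed.

Lemma coef_Lexp i : (L ^+ i)`_i = c ^+ i.
Proof.
elim: i => [|i IH]; first by rewrite !expr0 coef1.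
rewrite exprS mulrDl mul1r coefD nth_default ?size_Lexp // add0r.
by rewrite -scalerAl coefZ coefXM IH exprS.
Qed.

Lemma size_blowup f : size_graded (blowup f).
Proof.
move=> e; rewrite sc_blowup; apply: size_sum_leq => -[i /= ie].
apply: (@size_polyM_graded _ _ _ 0 e) => //; first by rewrite size_polyC leq_b1.
apply: (@size_polyM_graded _ _ _ i (e - i)); rewrite ?size_Lexp ?size_polyXn //.
by rewrite subnKC.
Qed.

Lemma coef_blowup_top f e :
  (sc (blowup f) e)`_e = \sum_(i < e.+1) scoef f i (e - i) * c ^+ i.
Proof.
rewrite sc_blowup coef_sum; apply: eq_bigr => -[i /= ie] _.
by rewrite coefCM coefMXn ltnNge leq_subr /= subKn // coef_Lexp.
Qed.

Lemma hornerL0 i : (L ^+ i).[0] = 1.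
Proof. by rewrite horner_exp /L hornerD hornerZ hornerX mulr0 addr0 hornerC expr1n. Qed.

Let form e (a : nat -> K) := \sum_(i < e.+1) (a i)%:P * (L ^+ i * 'X^(e - i)).

Lemma formS e a : form e.+1 a = form e a * 'X + (a e.+1)%:P * L ^+ e.+1.
Proof.
rewrite /form big_ord_recr /= subnn expr0 mulr1 mulr_suml; congr (_ + _).
apply: eq_bigr => -[i /= ie] _.
by rewrite -!mulrA -exprSr subSn.
Qed.

(** The coefficient of t^e is the value at T = 0; what remains is divisible by
    T. *)
Lemma form_onto e (p : {poly K}) : (size p <= e.+1)%N -> exists a, p = form e a.
Proof.
elim: e p => [|e IH] p sp.
  exists (fun=> p`_0); rewrite /form big_ord1 subnn !expr0 !mulr1.
  by apply: size1_polyC.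
pose r := p - (p.[0])%:P * L ^+ e.+1.
have /factor_theorem[q qE] : root r 0.
  by rewrite /root /r hornerD hornerN hornerM hornerL0 hornerC mulr1 subrr.
rewrite subr0 in qE.
have sr : (size r <= e.+2)%N.
  apply: leq_trans (size_polyD _ _) _; rewrite geq_max sp size_polyN /=.
  by apply: (@size_polyM_graded _ _ _ 0 e.+1); rewrite ?size_Lexp // size_polyC leq_b1.
have /IH[a aE] : (size q <= e.+1)%N.
  case: (eqVneq q 0) => [->|q0]; first by rewrite size_poly0.
  by move: sr; rewrite qE size_mulX.
exists (fun i => if i == e.+1 then p.[0] else a i).
rewrite formS eqxx.
have -> : form e (fun i => if i == e.+1 then p.[0] else a i) = form e a.
  by apply: eq_bigr => -[i /= ie] _; rewrite ltn_eqF.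
by rewrite -aE -qE /r subrK.
Qed.

Lemma form_eq0 e a : form e a = 0 -> forall i, (i <= e)%N -> a i = 0.
Proof.
elim: e => [|e IH].
  rewrite /form big_ord1 subnn !expr0 !mulr1 => /eqP; rewrite polyC_eq0 => /eqP a0 i.
  by rewrite leqn0 => /eqP ->.
rewrite formS => E; have ae : a e.+1 = 0.
  have := congr1 (fun p : {poly K} => p.[0]) E.
  by rewrite hornerD hornerM hornerX mulr0 add0r hornerM hornerL0 mulr1 !hornerE.
move: E; rewrite ae mul0r addr0 => /eqP; rewrite mulf_eq0 polyX_eq0 orbF => /eqP /IH H i.
by rewrite leq_eqVlt => /predU1P[->|/H].
Qed.

Lemma blowup_onto (g : ser {poly K}) : size_graded g -> exists f, blowup f = g.
Proof.
move=> sg; have /choice[a aE] : forall e, exists a, sc g e = form e a.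
  by move=> e; apply: form_onto.
exists (Series2 (fun i j => a (i + j)%N i)); apply: serP => e.
rewrite sc_blowup aE; apply: eq_bigr => -[i /= ie] _.
by rewrite subnKC.
Qed.

Lemma eqmod_blowup N f :
  eqmod N (blowup f) 0 <-> (forall i j, (i + j < N)%N -> scoef f i j = 0).
Proof.
split=> [H i j ijN|H e eN].
  have := H _ ijN; rewrite sc0 sc_blowup => /(@form_eq0 _ (fun i' => scoef f i' (i + j - i')%N)).
  by move=> /(_ i (leq_addr _ _)); rewrite addKn.
rewrite sc0 sc_blowup big1 // => -[i /= ie] _.
by rewrite H ?mul0r // subnKC.
Qed.

Lemma blowup_inj : injective blowup.
Proof.
move=> f g fg; apply: series2P => i j.
have: eqmod (i + j).+1 (blowup (f - g)) 0 by rewrite rmorphB /= fg subrr.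
by move/eqmod_blowup => /(_ i j (ltnSn _)) /eqP; rewrite /= subr_eq0 => /eqP.
Qed.

End Blowup.

(** * Powers of the ideal (t, z) *)

Section TZAdic.
Variable K : comNzRingType.
Implicit Types (f g : series2 K).

Lemma scoef_tvarM f i j :
  scoef (tvar K * f) i j = if i is i'.+1 then scoef f i' j else 0.
Proof.
rewrite /= /smul /=; case: i => [|i].
  by rewrite big_ord1 big1 // => b _; rewrite /= mul0r.
rewrite big_ord_recl big_ord_recl /= [X in X + _]big1 ?add0r => [|b _]; last by rewrite mul0r.
rewrite [X in _ + X]big1 ?addr0 => [|a _]; last by rewrite big1 // => b _; rewrite mul0r.
rewrite big_ord_recl /= mul1r big1 ?addr0 => [|b _]; last by rewrite mul0r.
by rewrite /bump /= subn1 subn0.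
Qed.

Lemma scoef_zvarM f i j :
  scoef (zvar K * f) i j = if j is j'.+1 then scoef f i j' else 0.
Proof.
rewrite /= /smul /= big_ord_recl /= [X in _ + X]big1 ?addr0 => [|a _]; last first.
  by rewrite big1 // => b _; rewrite mul0r.
rewrite subn0; case: j => [|j]; first by rewrite big_ord1 mul0r.
rewrite big_ord_recl /= mul0r add0r big_ord_recl /= mul1r big1 ?addr0 => [|b _].
  by rewrite /bump /= subn1.
by rewrite mul0r.
Qed.

Lemma tz_expP N f : tz_exp N f <-> forall i j, (i + j < N)%N -> scoef f i j = 0.
Proof.
split.
  elim: N f => // N IH f [m [c [s [sP ->]]]] i j ijN.
  have sumE r (F : 'I_r -> series2 K) i' j' :
      scoef (\sum_k F k) i' j' = \sum_k scoef (F k) i' j'.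
    by apply: (big_morph (fun f => scoef f i' j')).
  have ordM N' (g h : series2 K) : (forall i j, (i + j < N')%N -> scoef h i j = 0) ->
      forall i j, (i + j < N')%N -> scoef (g * h) i j = 0.
    move=> h0 i' j' ij'; rewrite /= big1 // => -[a /= ai] _.
    rewrite big1 // => -[b /= bj] _; rewrite h0 ?mulr0 //.
    by rewrite (leq_ltn_trans _ ij') // leq_add // leq_subr.
  rewrite sumE big1 // => k _; apply: (ordM N.+1) ijN => i1 j1 ijN1.
  have [a [b [[m' [c' [s' [s'P ->]]]] bN ->]]] := sP k.
  have {}bN := IH _ bN.
  rewrite mulr_suml sumE.
  rewrite big1 // => l _; rewrite -mulrA; apply: (ordM N.+1) ijN1 => i2 j2 ijN2.
  case: (s'P l) => ->.
    by rewrite scoef_tvarM; case: i2 ijN2 => // i2 ijN2; apply: bN; rewrite -ltnS -addSn.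
  by rewrite scoef_zvarM; case: j2 ijN2 => // j2 ijN2; apply: bN; rewrite -ltnS -addnS.
elim: N f => // N IH f f0.
pose ft := Series2 (fun i j => scoef f i.+1 j).
pose fz := Series2 (fun i j => if i == 0%N then scoef f 0 j.+1 else 0).
have fE : f = tvar K * ft + zvar K * fz.
  apply: series2P => i j; rewrite -[RHS]/(scoef _ i j + scoef _ i j).
  rewrite scoef_tvarM scoef_zvarM; case: i => [|i]; case: j => [|j] /=;
    by rewrite ?addr0 ?add0r // f0.
have gen x : [set tvar K; zvar K]%classic x ->
    ideal_gen [set tvar K; zvar K]%classic x.
  by move=> Sx; exists 1%N, (fun=> 1), (fun=> x); split=> //; rewrite big_ord1 mul1r.
exists 2%N, (fun=> 1), (fun k : 'I_2 => if k == 0 then tvar K * ft else zvar K * fz).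
split; last by rewrite big_ord_recl big_ord1 /= !mul1r -fE.
move=> k; case: ifP => _.
  exists (tvar K), ft; split=> //; first by apply: gen; left.
  by apply: IH => i j ij; apply: f0; rewrite addSn ltnS.
exists (zvar K), fz; split=> //; first by apply: gen; right.
apply: IH => i j ij /=; case: eqP => // i0; apply: f0.
by rewrite i0 add0n in ij *; rewrite ltnS.
Qed.

End TZAdic.

(** * Solutions of bounded order *)

Section Uniqueness.
Variable K : fieldType.
Implicit Types (U V : ser {poly K}) (P Q : {poly ser K}).

Lemma size_swap_gt0 d P k : P \is monic -> size P = d.+1 -> (0 < k)%N ->
  (size (sc (swap P) k) <= d)%N.
Proof.
move=> Pm sP k0; apply/leq_sizeP => l; rewrite leq_eqVlt => /predU1P[<-|dl].
  have := monicP Pm; rewrite lead_coefE sP coef_swap /= => ->.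
  by rewrite sc1 eqn0Ngt k0.
by rewrite nth_default // (leq_trans (size_swap _ _)) // sP.
Qed.

Lemma coef_swap_top d P : P \is monic -> size P = d.+1 -> (sc (swap P) 0)`_d = 1.
Proof.
by move=> Pm sP; have := monicP Pm; rewrite lead_coefE sP coef_swap /= => ->.
Qed.

(** In degree k the difference of the monic factors has degree less than d,
    hence cannot be a nonzero multiple of the leading form. *)
Lemma weierstrass_uniq N d U V P Q (a b : K) :
  P \is monic -> size P = d.+1 -> Q \is monic -> size Q = d.+1 ->
  sc U 0 = a%:P -> a != 0 -> sc V 0 = b%:P ->
  eqmod N (U * swap P) (V * swap Q) ->
  eqmod N U V /\ eqmod N (swap P) (swap Q).
Proof.
move=> Pm sP Qm sQ U0 a0 V0 UV.
suff H k : (k < N)%N -> sc U k = sc V k /\ sc (swap P) k = sc (swap Q) k.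
  by split=> k /H[].
have [m] := ubnP k; elim: m k => // m IH [|k] km kN.
  have := UV 0%N kN; rewrite !scM0 U0 V0 !mul_polyC => E.
  have ab : a = b.
    have := congr1 (fun p : {poly K} => p`_d) E.
    by rewrite !coefZ !coef_swap_top // !mulr1.
  split; first by rewrite ab.
  have := congr1 (fun p : {poly K} => a^-1 *: p) E.
  by rewrite -ab !scalerA mulVf // !scale1r.
have [_ PQ0] := IH 0%N (leq_ltn_trans (leq0n k) km) (leq_ltn_trans (leq0n _) kN).
have [UV0 _] := IH 0%N (leq_ltn_trans (leq0n k) km) (leq_ltn_trans (leq0n _) kN).
have := UV k.+1 kN; rewrite !scM big_ord_recl [in RHS]big_ord_recl.
rewrite big_ord_recr [in RHS]big_ord_recr /= /bump /= !add1n !subnn !subn0.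
rewrite -UV0 -PQ0 U0.
set mid := \sum_(i < k) _; set mid' := \sum_(i < k) _.
have -> : mid = mid'.
  apply: eq_bigr => -[l /= lk] _; rewrite add1n subSS.
  have [||-> _] := IH l.+1; [lia|lia|].
  by have [||_ ->] := IH (k - l)%N; [lia|lia|].
move=> E.
have {}E : a *: (sc (swap P) k.+1 - sc (swap Q) k.+1) =
    (sc V k.+1 - sc U k.+1) * sc (swap P) 0.
  rewrite -mul_polyC.
  apply: (@addIr _ (a%:P * sc (swap Q) k.+1 + mid' + sc U k.+1 * sc (swap P) 0)).
  transitivity (a%:P * sc (swap P) k.+1 + (mid' + sc U k.+1 * sc (swap P) 0)).
    by ring.
  by rewrite E; ring.
have UVk : sc U k.+1 = sc V k.+1.
  apply/eqP; rewrite eq_sym -subr_eq0; apply: contraT => UVn.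
  have s0 : (d < size (sc (swap P) 0))%N.
    rewrite ltnNge; apply/negP => /leq_sizeP /(_ d (leqnn d)) /eqP.
    by rewrite coef_swap_top // oner_eq0.
  have P0n : sc (swap P) 0 != 0 by rewrite -size_poly_gt0 (leq_ltn_trans _ s0).
  have : (size (a *: (sc (swap P) k.+1 - sc (swap Q) k.+1)) <= d)%N.
    apply: leq_trans (size_scale_leq _ _) _; apply: leq_trans (size_polyD _ _) _.
    by rewrite geq_max size_polyN !size_swap_gt0.
  rewrite E size_mul //; move: UVn s0; rewrite -size_poly_gt0.
  by move: (size _) (size _) => p q; lia.
split=> //; move: E; rewrite UVk subrr mul0r => /eqP.
by rewrite scaler_eq0 (negPf a0) subr_eq0 => /eqP.
Qed.

End Uniqueness.

Section Core.
Variable K : closedFieldType.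
Hypothesis charK0 : [pchar K] =i pred0.
Notation L := {poly K}.

Lemma tz_exp_blowup (c : K) N f : tz_exp N f <-> eqmod N (blowup c f) 0.
Proof. by rewrite tz_expP; split=> /eqmod_blowup. Qed.

Lemma tz_ord_blowup (c : K) f d : tz_ord f d <-> has_order d (blowup c f).
Proof.
split=> [[fd nfd]|[f0 fd]].
  split; first exact/tz_exp_blowup.
  apply/eqP => fd0; apply: nfd; apply/(tz_exp_blowup c) => k.
  rewrite ltnS leq_eqVlt => /predU1P[->|kd]; first by rewrite fd0 sc0.
  by move/(tz_exp_blowup c): fd => ->.
split; first exact/(tz_exp_blowup c).
by move=> /(tz_exp_blowup c) /(_ d (ltnSn d)) E; rewrite E sc0 eqxx in fd.
Qed.

(** The top coefficients are the values at c of the dehomogenized leading forms;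
    some c is a root of none of them. *)
Lemma generic_blowup n (x : 'I_n -> series2 K) (d : 'I_n -> nat) :
  (forall j, tz_ord (x j) (d j)) ->
  exists c, forall j, (sc (blowup c (x j)) (d j))`_(d j) != 0.
Proof.
move=> xd.
pose p j : L := \poly_(i < (d j).+1) scoef (x j) i (d j - i).
have p0 j : p j != 0.
  apply/eqP => pj; have [xj nxj] := xd j; apply: nxj; apply/tz_expP => a b.
  rewrite ltnS leq_eqVlt => /predU1P[abd|]; last by move/tz_expP: xj => /[apply].
  have := congr1 (fun q : L => q`_a) pj; rewrite coef0 coef_poly ltnS -abd.
  by rewrite leq_addr addKn.
have /closed_nonrootP[c] : \prod_j p j != 0 by apply/prodf_neq0 => j _.
rewrite /root horner_prod => /prodf_neq0 c0; exists c => j.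
rewrite coef_blowup_top; have := c0 j isT.
by rewrite horner_poly.
Qed.

Lemma rmorph_power n (R S : comNzRingType) (f : {rmorphism R -> S})
    (x : 'I_n -> R) u : f (power x u) = power (fun j => f (x j)) u.
Proof. by rewrite rmorph_prod; apply: eq_bigr => j _; rewrite rmorphXn. Qed.

Lemma powerM n (R : comNzRingType) (x y : 'I_n -> R) u :
  power (fun j => x j * y j) u = power x u * power y u.
Proof. by rewrite -big_split; apply: eq_bigr => j _; rewrite exprMn. Qed.

Lemma power_svar n (R : comNzRingType) (d u : 'I_n -> nat) :
  power (fun j => svar R ^+ d j) u = svar R ^+ weight u d.
Proof.
rewrite /weight (big_morph (fun e => svar R ^+ e) (exprD _) (expr0 _)).
by apply: eq_bigr => j _; rewrite mulnC exprM.
Qed.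

Lemma has_order_power n (R : idomainType) (F : 'I_n -> ser R) (d u : 'I_n -> nat) :
  (forall j, has_order (d j) (F j)) -> has_order (weight u d) (power F u).
Proof. by move=> Fd; apply: has_order_prod => j; apply: has_orderX. Qed.

Lemma has_order_const a N (f : ser L) : a != 0 ->
  has_order N f -> has_order N (ser_const a%:P * f).
Proof.
move=> a0 fN; rewrite -[N]add0n; apply: has_orderM => //.
by apply: has_order0; rewrite sc_const polyC_eq0.
Qed.

Lemma size_gradedM (f g : ser L) :
  size_graded f -> size_graded g -> size_graded (f * g).
Proof.
move=> sf sg k; rewrite scM; apply: size_sum_leq => -[l /= lk].
by apply: (@size_polyM_graded _ _ _ l (k - l)); rewrite ?subnKC.
Qed.

Lemma blowup_weierstrass c f d : tz_ord f d ->
  (sc (blowup c f) d)`_d != 0 ->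
  exists (U : ser L) (P : {poly ser K}) (lam : K),
    [/\ blowup c f = svar L ^+ d * (U * swap P), P \is monic /\ size P = d.+1,
        sc U 0 = lam%:P /\ lam != 0 & size_graded U].
Proof.
move=> /(tz_ord_blowup c)[f0 fd] top.
pose F : ser L := Ser (fun k => sc (blowup c f) (d + k)).
have FE : blowup c f = svar L ^+ d * F.
  apply: serP => k; rewrite sc_svarXM; case: ltnP => [/f0 ->|dk]; first by rewrite sc0.
  by rewrite [sc F _]/(sc (blowup c f) _) subnKC.
have sF k : (size (sc F k) <= (d + k).+1)%N by apply: size_blowup.
have s0 : size (sc F 0) = d.+1.
  apply/eqP; rewrite eqn_leq; have := sF 0%N; rewrite addn0 => -> /=.
  rewrite ltnNge; apply/negP => /leq_sizeP /(_ d (leqnn d)) /eqP.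
  by rewrite [sc F _]/(sc (blowup c f) _) addn0 (negPf top).
have [U [P [lam [FUP ? ? ?]]]] := weierstrass s0 sF.
by exists U, P, lam; rewrite FE FUP.
Qed.

(** Approximate solutions, all of whose components have bounded order, of a
    system of equations between two monomials: after the blow-up each component
    is a power of s, times a unit, times a monic polynomial; by uniqueness of
    this factorisation units and polynomials satisfy the system separately, and
    each part is corrected on its own. *)
Lemma approx_bounded_order n (x : 'I_n -> series2 K) (d : 'I_n -> nat)
    (E : K -> K -> ('I_n -> nat) -> ('I_n -> nat) -> Prop) D i N :
  (forall j, tz_ord (x j) (d j)) ->
  (i.+1 * D.+1 + D <= N)%N ->
  (forall a b u v, E a b u v ->
     [/\ a != 0 /\ b != 0, (weight u d <= D)%N &
         tz_exp N (sconst a * power x u - sconst b * power x v)]) ->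
  exists y : 'I_n -> series2 K,
    (forall j, tz_exp i (y j - x j)) /\
    (forall a b u v, E a b u v -> sconst a * power y u = sconst b * power y v).
Proof.
move=> xd DN EP; have [c top] := generic_blowup xd.
have /choice[U] : forall j, exists U, exists (P : {poly ser K}) (lam : K),
    [/\ blowup c (x j) = svar L ^+ d j * (U * swap P), P \is monic /\ size P = (d j).+1,
        sc U 0 = lam%:P /\ lam != 0 & size_graded U].
  by move=> j; apply: blowup_weierstrass (xd j) (top j).
move=> /choice[P] /choice[lam UP].
have xE j : blowup c (x j) = svar L ^+ d j * (U j * swap (P j)) by case: (UP j).
have Pm j : P j \is monic by case: (UP j) => _ [].
have sP j : size (P j) = (d j).+1 by case: (UP j) => _ [].
have U0 j : sc (U j) 0 = (lam j)%:P by case: (UP j) => _ _ [].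
have lam0 j : lam j != 0 by case: (UP j) => _ _ [].
have sU j : size_graded (U j) by case: (UP j).
have powE (X : 'I_n -> series2 K) (W : 'I_n -> ser L) (Q : 'I_n -> {poly ser K}) a u :
    (forall j, blowup c (X j) = svar L ^+ d j * (W j * swap (Q j))) ->
    blowup c (sconst a * power X u) =
    svar L ^+ weight u d * (ser_const a%:P * power W u * swap (power Q u)).
  move=> XE; rewrite rmorphM /= blowup_const (rmorph_power (blowup c)).
  rewrite (rmorph_power (@swap K)).
  have -> : power (fun j => blowup c (X j)) u =
      power (fun j => svar L ^+ d j * (W j * swap (Q j))) u.
    by apply: eq_bigr => j _; rewrite XE.
  by rewrite !powerM power_svar; ring.
have monic_power u : power P u \is monic.
  by apply: monic_prod => j _; apply: monic_exp.
have size_power u : size (power P u) = (weight u d).+1.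
  rewrite size_prod => [|j _]; last by rewrite monic_neq0 // monic_exp.
  have H : (\sum_j size (P j ^+ u j) = weight u d + #|'I_n|)%N.
    rewrite -sum1_card -big_split; apply: eq_bigr => j _ /=.
    have Pu : (0 < size (P j ^+ u j))%N.
      by rewrite size_poly_gt0 monic_neq0 // monic_exp.
    by rewrite -(prednK Pu) size_exp sP mulnC addn1.
  by rewrite H -addSn; exact: addnK.
pose N0 := (N - D)%N.
have N0D : (i.+1 * D.+1 <= N0)%N by rewrite /N0; lia.
have N0i : (i.+1 <= N0)%N by apply: leq_trans N0D; rewrite leq_pmulr.
have sep a b u v : E a b u v ->
    [/\ a != 0, (weight u d <= D)%N /\ weight u d = weight v d,
        eqmod N0 (ser_const a%:P * power U u) (ser_const b%:P * power U v) &
        eqmod N0 (swap (power P u)) (swap (power P v))].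
  move=> /EP[[a0 b0] uD /(tz_exp_blowup c)]; rewrite rmorphB /= => uvN.
  have {}uvN : eqmod N (blowup c (sconst a * power x u)) (blowup c (sconst b * power x v)).
    by move=> k kN; apply/eqP; rewrite -subr_eq0 -scB uvN.
  have ordx a' w : a' != 0 -> has_order (weight w d) (blowup c (sconst a' * power x w)).
    move=> a'0; rewrite rmorphM /= blowup_const rmorph_power; apply: has_order_const => //.
    by apply: has_order_power => j; apply/tz_ord_blowup.
  have uvw : weight u d = weight v d.
    apply: has_order_uniq (ordx b v b0).
    by apply: has_order_eqmod uvN _ (ordx a u a0); lia.
  have pow0 a' w : sc (ser_const a'%:P * power U w) 0 = (a' * \prod_j lam j ^+ w j)%:P.
    rewrite scM0 sc_const polyCM sc0_prod rmorph_prod; congr (_ * _).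
    by apply: eq_bigr => j _; rewrite sc0X U0 rmorphXn.
  have [||||||H1 H2] := @weierstrass_uniq _ N0 (weight u d)
      (ser_const a%:P * power U u) (ser_const b%:P * power U v)
      (power P u) (power P v) _ _ _ _ _ _ (pow0 a u) _ (pow0 b v).
  - exact: monic_power.
  - exact: size_power.
  - exact: monic_power.
  - by rewrite uvw size_power.
  - rewrite mulf_neq0 //; apply/prodf_neq0 => j _; exact: expf_neq0.
  - move=> k kN; have kN' : (k + weight u d < N)%N by rewrite /N0 in kN; lia.
    have := uvN _ kN'; rewrite !(powE _ _ _ _ _ xE) -uvw !sc_svarXM.
    by rewrite ltnNge leq_addl addnK.
  by split.
have [||u v [a [b /sep[_ [uD wuv] _ H]]]|Q [sQ QP QE]] :=
    @toric_polys _ charK0 n P d (fun u v => exists a b, E a b u v) i.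
- exact: Pm.
- exact: sP.
- split=> //; exists N0 => //; apply: leq_trans N0D.
  by rewrite ltn_pmul2l // ltnS.
have [|||||V [sV VU VE]] := @toric_units _ charK0 n U lam E N0.
- exact: leq_trans N0i.
- exact: U0.
- exact: lam0.
- exact: sU.
- by move=> a b u v /sep[].
have /choice[y yE] : forall j, exists y, blowup c y = svar L ^+ d j * (V j * swap (Q j)).
  move=> j; apply: blowup_onto; rewrite mulrCA; apply: size_gradedM => // k.
  rewrite sc_svarXM; case: ltnP => [_|dk]; first by rewrite size_poly0.
  by apply: leq_trans (size_swap _ _) _; rewrite sQ.
exists y; split=> [j|a b u v Eab].
  apply/(tz_exp_blowup c) => k ki; rewrite rmorphB /= xE yE -mulrBr sc_svarXM sc0.
  case: ltnP => // dk; rewrite scB; apply/eqP; rewrite subr_eq0; apply/eqP.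
  have lt : (k - d j < i.+1)%N by lia.
  by apply: (@eqmodM _ i.+1) lt => //; move=> l li; apply: VU; apply: leq_trans li N0i.
have [_ [_ wuv] _ _] := sep _ _ _ _ Eab.
apply: (@blowup_inj _ c); rewrite !(powE _ _ _ _ _ yE) wuv (VE _ _ _ _ Eab).
by rewrite (QE u v) //; exists a, b.
Qed.

End Core.

(** * Systems of binomials *)

Section Binomials.
Variables (K : comNzRingType) (n : nat).
Implicit Types (f : {mpoly K[n]}) (x : 'I_n -> series2 K).

Lemma binomial_cases d (f : {mpoly K[n]}) : binomial_deg_le d f ->
  [\/ f = 0,
      exists a (u : 'X_{1..n}), [/\ a != 0, f = a *: 'X_[u] & (mdeg u <= d)%N] |
      exists a b (u v : 'X_{1..n}),
        [/\ a != 0 /\ b != 0, f = a *: 'X_[u] - b *: 'X_[v],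
            (mdeg u <= d)%N & (mdeg v <= d)%N]].
Proof.
move=> [[a [b [u [v fE]]]] sf].
have degle w : f@_w != 0 -> (mdeg w <= d)%N.
  by rewrite -mcoeff_msupp => /msize_mdeg_lt wf; rewrite -ltnS (leq_trans wf).
have fw w : f@_w = a * (u == w)%:R + b * (v == w)%:R.
  by rewrite fE mcoeffD !mcoeffZ !mcoeffX.
case: (eqVneq u v) fE => [->|uv] fE.
  have {}fE : f = (a + b) *: 'X_[v] by rewrite scalerDl.
  have [ab0|ab0] := eqVneq (a + b) 0; first by constructor 1; rewrite fE ab0 scale0r.
  constructor 2; exists (a + b), v; split=> //; apply: degle.
  by rewrite fE mcoeffZ mcoeffX eqxx mulr1.
have fu : f@_u = a by rewrite fw eqxx eq_sym (negPf uv) mulr0 addr0 mulr1.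
have fv : f@_v = b by rewrite fw eqxx (negPf uv) mulr0 add0r mulr1.
have [a0|a0] := eqVneq a 0; have [b0|b0] := eqVneq b 0.
- by constructor 1; rewrite fE a0 b0 !scale0r addr0.
- constructor 2; exists b, v; split=> //; last by rewrite degle ?fv.
  by rewrite fE a0 scale0r add0r.
- constructor 2; exists a, u; split=> //; last by rewrite degle ?fu.
  by rewrite fE b0 scale0r addr0.
- constructor 3; exists a, (- b), u, v; split; rewrite ?oppr_eq0 ?degle ?fu ?fv //.
  by rewrite scaleNr opprK.
Qed.

Lemma meval_monomial a (u : 'X_{1..n}) x :
  (extend_coef (a *: 'X_[u])).@[x] = sconst a * power x u.
Proof. by rewrite /extend_coef map_mpolyZ map_mpolyX mevalZ mevalX. Qed.

Lemma meval_extendB f g x :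
  (extend_coef (f - g)).@[x] = (extend_coef f).@[x] - (extend_coef g).@[x].
Proof. by rewrite /extend_coef rmorphB /= mevalB. Qed.

Lemma extend_ideal_gen (S : set {mpoly K[n]}) f :
  S f -> extend_ideal (ideal_gen S) (extend_coef f).
Proof.
move=> Sf; exists 1%N, (fun=> 1), (fun=> extend_coef f); split=> [k|].
  exists f => //; exists 1%N, (fun=> 1), (fun=> f); split=> //.
  by rewrite big_ord1 mul1r.
by rewrite big_ord1 mul1r.
Qed.

Lemma meval_extend_ideal (S : set {mpoly K[n]}) y F :
  (forall f, S f -> (extend_coef f).@[y] = 0) ->
  extend_ideal (ideal_gen S) F -> F.@[y] = 0.
Proof.
move=> Sy [m [c [s [sI ->]]]]; rewrite raddf_sum big1 // => k _.
rewrite /= mevalM; have [f [m' [c' [s' [s'S ->]]]] <-] := sI k.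
rewrite /extend_coef (raddf_sum (map_mpoly (@sconst K))) (raddf_sum (meval y)).
rewrite big1 ?mulr0 // => l _ /=; rewrite (rmorphM (map_mpoly (@sconst K))) /= mevalM.
by rewrite [X in _ * X]Sy ?mulr0.
Qed.

End Binomials.

(** * Approximation *)

Section Approximation.
Variables (K : closedFieldType) (n : nat).
Hypothesis charK0 : [pchar K] =i pred0.
Implicit Types (f : {mpoly K[n]}) (x y : 'I_n -> series2 K).

Lemma weight_le (u d : 'I_n -> nat) T :
  (forall j, d j <= T)%N -> (weight u d <= (\sum_j u j) * T)%N.
Proof.
by move=> dT; rewrite big_distrl; apply: leq_sum => j _; rewrite leq_mul2l dT orbT.
Qed.

Lemma tz_exp_le N M (g : series2 K) : (M <= N)%N -> tz_exp N g -> tz_exp M g.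
Proof.
by move=> MN /tz_expP g0; apply/tz_expP => i j ij; apply: g0; apply: leq_trans ij MN.
Qed.

Lemma tz_expB M (g h : series2 K) : tz_exp M g -> tz_exp M h -> tz_exp M (g - h).
Proof.
move=> /tz_expP g0 /tz_expP h0; apply/tz_expP => a b ab.
by rewrite /= g0 // h0 // subr0.
Qed.

Lemma tz_exp0 M : tz_exp M (0 : series2 K).
Proof. exact/tz_expP. Qed.

Lemma tz_ord1 : tz_ord (1 : series2 K) 0.
Proof. by apply/(tz_ord_blowup 0); rewrite rmorph1; exact: has_order1. Qed.

(** Components of order at least T' are replaced by 0.  The gap between T and T'
    makes this harmless: a monomial in the other components has order at most
    d' T < T', so an equation with one monomial involving a large component has
    both.  The equations without large component are solved by
    approx_bounded_order, in which 1 stands for the large components. *)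
Lemma approx_gap d' (S : set {mpoly K[n]}) x i T T' N :
  (forall f, S f -> binomial_deg_le d' f) ->
  (forall j, (exists2 d, (d <= T)%N & tz_ord (x j) d) \/ tz_exp T' (x j)) ->
  (d' * T < T')%N -> (i <= T')%N ->
  (i.+1 * (d' * T).+1 + d' * T <= N)%N ->
  (forall f, S f -> tz_exp N (extend_coef f).@[x]) ->
  exists y, (forall f, S f -> (extend_coef f).@[y] = 0) /\
            (forall j, tz_exp i (y j - x j)).
Proof.
move=> Sbin xT TT' iT' DN Sx; set D := (d' * T)%N in TT' DN.
pose big j : bool := ~~ `[< exists2 d, (d <= T)%N & tz_ord (x j) d >].
have bigT' j : big j -> tz_exp T' (x j).
  by move=> /asboolP; case: (xT j).
have /choice[d dP] : forall j, exists d, (d <= T)%N /\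
    tz_ord (if big j then 1 else x j) d.
  move=> j; case: ifP => [_|/negbT].
    by exists 0%N; split=> //; exact: tz_ord1.
  by rewrite negbK => /asboolP[d dT xd]; exists d.
pose x' j := if big j then 1 else x j.
have free_or (u : 'X_{1..n}) :
    (forall j, big j -> u j = 0%N) \/ exists2 j, big j & u j != 0%N.
  have [|H] := pselect (exists2 j, big j & u j != 0%N); first by right.
  left=> j bj; apply/eqP; apply: contrapT => /negP uj; apply: H.
  by exists j.
have power_free (u : 'X_{1..n}) : (forall j, big j -> u j = 0%N) ->
    power x' u = power x u.
  move=> u0; apply: eq_bigr => j _; rewrite /x'; case: ifP => // /u0 ->.
  by rewrite !expr0.
have wD (u : 'X_{1..n}) : (mdeg u <= d')%N -> (weight u d <= D)%N.
  move=> ud; apply: leq_trans (@weight_le _ _ T _) _ => [j|]; first by case: (dP j).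
  by rewrite leq_mul2r -mdegE ud orbT.
have ord_free a (u : 'X_{1..n}) M : a != 0 -> (mdeg u <= d')%N ->
    (forall j, big j -> u j = 0%N) ->
    tz_exp M (sconst a * power x u) -> (M <= D)%N.
  move=> a0 ud u0 /(tz_exp_blowup 0) xM; apply: leq_trans (wD u ud).
  apply: has_order_le xM _; rewrite -power_free // rmorphM /= blowup_const rmorph_power.
  apply: has_order_const => //; apply: has_order_power => j.
  by apply/(tz_ord_blowup 0); case: (dP j).
have tz_big a (u : 'X_{1..n}) j : big j -> u j != 0%N ->
    tz_exp T' (sconst a * power x u).
  move=> bj uj; apply/(tz_exp_blowup 0); rewrite /power (bigD1 j) //=.
  rewrite -(prednK (_ : 0 < u j)%N) ?lt0n // exprS -mulrA [X in blowup _ X]mulrCA.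
  rewrite rmorphM /=; set r := (X in eqmod _ (_ * X) _).
  rewrite -(mul0r r); apply: eqmodM => //.
  by apply/(tz_exp_blowup 0); exact: bigT'.
have DN' : (D < N)%N by lia.
pose E a b (u v : 'I_n -> nat) := exists mu mv : 'X_{1..n},
  [/\ a != 0 /\ b != 0, u = mu /\ v = mv,
      (mdeg mu <= d')%N /\ (mdeg mv <= d')%N,
      (forall j, big j -> mu j = 0%N) /\ (forall j, big j -> mv j = 0%N) &
      S (a *: 'X_[mu] - b *: 'X_[mv])].
have [|||y [yx yE]] := @approx_bounded_order K charK0 n x' d E D i N.
- by move=> j; case: (dP j).
- exact: DN.
- move=> a b _ _ [mu [mv [ab0 [-> ->] [ud vd] [u0 v0] Sf]]]; split=> //.
    exact: wD.
  rewrite (power_free mu u0) (power_free mv v0) -!meval_monomial -meval_extendB.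
  exact: Sx.
exists (fun j => if big j then 0 else y j); split; last first.
  move=> j; have := yx j; rewrite /x'; case: ifP => // bj _.
  rewrite sub0r; apply/(tz_exp_blowup 0) => k ki; rewrite rmorphN scN.
  by have /(tz_exp_blowup 0) -> := bigT' j bj; rewrite ?sc0 ?oppr0 // (leq_trans ki).
have power_y (u : 'X_{1..n}) : (forall j, big j -> u j = 0%N) ->
    power (fun j => if big j then 0 else y j) u = power y u.
  by move=> u0; apply: eq_bigr => j _; case: ifP => // /u0 ->; rewrite !expr0.
have power_y0 (u : 'X_{1..n}) j : big j -> u j != 0%N ->
    power (fun j => if big j then 0 else y j) u = 0.
  by move=> bj uj; rewrite /power (bigD1 j) //= bj expr0n (negPf uj) mul0r.
have mixed a b (u v : 'X_{1..n}) j : a != 0 -> (mdeg u <= d')%N ->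
    (forall j, big j -> u j = 0%N) -> big j -> v j != 0%N ->
    tz_exp N (sconst a * power x u - sconst b * power x v) -> False.
  move=> a0 ud u0 bj vj xN.
  have [M MN [MT DM]] : exists2 M, (M <= N)%N & (M <= T')%N /\ (D < M)%N.
    by exists (minn N T'); lia.
  have := ord_free a u M a0 ud u0; rewrite leqNgt DM => H.
  suff /H : tz_exp M (sconst a * power x u) by [].
  rewrite -[_ * _](subrK (sconst b * power x v)) -[X in _ + X]opprK.
  apply: tz_expB (tz_exp_le MN xN) _.
  rewrite -sub0r; apply: tz_expB (tz_exp0 M) _.
  exact: tz_exp_le MT (tz_big b v j bj vj).
move=> f Sf; have fx := Sx f Sf.
case: (binomial_cases (Sbin f Sf)) => [fE|[a [u [a0 fE ud]]]|].
- by rewrite fE /extend_coef rmorph0 meval0.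
- move: fx; rewrite fE !meval_monomial => fx.
  case: (free_or u) => [u0|[j bj uj]].
    by have := ord_free a u N a0 ud u0 fx; rewrite leqNgt DN'.
  by rewrite (power_y0 u j) // mulr0.
move=> [a [b [u [v [[a0 b0] fE ud vd]]]]].
have evalE z : (extend_coef f).@[z] = sconst a * power z u - sconst b * power z v.
  by rewrite fE meval_extendB; congr (_ - _); exact: meval_monomial.
rewrite evalE in fx; rewrite evalE.
case: (free_or u) => [u0|[j bj uj]]; case: (free_or v) => [v0|[k bk vk]].
- rewrite !power_y // (yE a b u v) ?subrr //; exists u, v; split=> //.
  by rewrite -fE.
- by case: (mixed a b u v k).
- case: (mixed b a v u j) => //.
  by rewrite -opprB -sub0r; apply: tz_expB (tz_exp0 N) fx.
- by rewrite (power_y0 u j) // (power_y0 v k) // !mulr0 subrr.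
Qed.

Lemma tz_ord_or_exp (g : series2 K) M :
  (exists2 d, (d < M)%N & tz_ord g d) \/ tz_exp M g.
Proof.
case: (eqVneq (blowup 0 g) 0) => [g0|/ex_has_order[d gd]].
  by right; apply/(tz_exp_blowup 0); rewrite g0.
have [dM|Md] := ltnP d M; first by left; exists d => //; apply/(tz_ord_blowup 0).
right; apply: tz_exp_le Md _; apply/(tz_exp_blowup 0).
by case: gd.
Qed.

Fixpoint threshold d' i s : nat :=
  if s is s'.+1 then (d'.+1 * threshold d' i s').+1 else i.

Lemma leq_threshold d' i s t : (s <= t)%N -> (threshold d' i s <= threshold d' i t)%N.
Proof.
move=> st; rewrite -(subnK st) addnC; elim: (t - s)%N => [|k IH]; first by rewrite addn0.
by rewrite addnS /=; nia.
Qed.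

Lemma threshold_bound d' i s : (threshold d' i s < i.+1 * d'.+2 ^ s)%N.
Proof.
elim: s => [|s IH]; first by rewrite expn0 muln1.
by rewrite /= expnS; nia.
Qed.

(** There are n + 1 disjoint gaps and only n components. *)
Lemma order_gap d' i x : exists2 s, (s <= n)%N &
  forall j, (exists2 d, (d <= threshold d' i s)%N & tz_ord (x j) d) \/
            tz_exp (threshold d' i s.+1) (x j).
Proof.
apply: contrapT => H.
have /choice[f fP] : forall s : 'I_n.+1, exists j,
    ~ ((exists2 d, (d <= threshold d' i s)%N & tz_ord (x j) d) \/
       tz_exp (threshold d' i s.+1) (x j)).
  move=> s; apply/existsNP => sP; apply: H; exists s => //.
  by rewrite -ltnS.
have finj : injective f.
  have lt (s t : 'I_n.+1) : (s < t)%N -> f s = f t -> False.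
    move=> st fst; have [] := tz_ord_or_exp (x (f s)) (threshold d' i s.+1).
      move=> [d ds xd]; apply: (fP t); left; exists d; last by rewrite -fst.
      by apply: leq_trans (ltnW ds) _; apply: leq_threshold.
    by move=> xs; apply: (fP s); right.
  move=> s t fst; case: (ltngtP s t) => [/lt/(_ fst)//|ts|/val_inj //].
  by case: (lt _ _ ts).
by have := leq_card f finj; rewrite !card_ord ltnn.
Qed.

(** The estimate obtained is (i + 1)(i + 2) times a constant; it is rounded up to
    a double exponential. *)
Definition artin_bound d' i : nat :=
  let C := (2 * (d'.+1 * d'.+2 ^ n)).+2.+2 in (C ^ (C ^ i))%N.

Lemma artin_bound_ge d' i s T : (s <= n)%N -> T = threshold d' i s ->
  (i.+1 * (d' * T).+1 + d' * T <= artin_bound d' i)%N.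
Proof.
move=> sn TE; have := threshold_bound d' i s; rewrite -TE => bT.
have {}bT : (T < i.+1 * d'.+2 ^ n)%N.
  by apply: leq_trans bT _; rewrite leq_mul2l leq_pexp2l.
rewrite /artin_bound; set A := (d'.+1 * d'.+2 ^ n)%N; set C := (2 * A).+4.
have leA : (i.+1 * (d' * T).+1 + d' * T <= i.+2 * (i.+1 * A))%N.
  have : ((d' * T).+1 <= i.+1 * A)%N.
    by rewrite mulnCA; nia.
  by nia.
apply: leq_trans leA _.
have C1 : (1 < C)%N by [].
have iC : (i < 2 ^ i)%N by apply: ltn_expl.
have sq : ((i.+1) * i.+1 <= C ^ i)%N.
  apply: (@leq_trans (4 ^ i)); last by case: (i) => // k; rewrite leq_exp2r.
  by rewrite -[4%N]/(2 * 2)%N expnMn leq_mul.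
apply: (@leq_trans (C ^ i.+1)).
  rewrite expnS; apply: (@leq_trans (2 * A * (i.+1 * i.+1))); first by nia.
  by apply: leq_mul => //; rewrite /C; lia.
rewrite leq_pexp2l //; apply: leq_trans iC _.
by case: (i) => // k; rewrite leq_exp2r.
Qed.

Lemma artin_approx_bound d' (S : set {mpoly K[n]}) i :
  (forall f, S f -> binomial_deg_le d' f) ->
  artin_approx (extend_ideal (ideal_gen S)) i (artin_bound d' i).
Proof.
move=> Sbin x xJ; have [s sn sP] := order_gap d' i x.
have [|||f Sf|y [Sy yx]] := @approx_gap d' S x i _ _ (artin_bound d' i) Sbin sP.
- by rewrite /=; nia.
- by apply: leq_trans (leq_threshold _ _ (leq0n s.+1)).
- exact: artin_bound_ge sn _.
- by apply: xJ; apply: extend_ideal_gen.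
by exists y; split=> // F; apply: meval_extend_ideal.
Qed.

End Approximation.

Lemma artin_function_le (K : comNzRingType) n (J : set {mpoly (series2 K)[n]}) beta :
  (forall i, artin_approx J i (beta i)) ->
  exists2 alpha, is_artin_function J alpha & forall i, (alpha i <= beta i)%N.
Proof.
move=> Jb.
have /choice[alpha aP] : forall i, exists m, artin_approx J i m /\
    forall m', artin_approx J i m' -> (m <= m')%N.
  move=> i; have ex : exists m, `[< artin_approx J i m >].
    by exists (beta i); apply/asboolP.
  case: (ex_minnP ex) => m /asboolP mP mmin; exists m; split=> // m' m'P.
  by apply: mmin; apply/asboolP.
exists alpha; last by move=> i; apply: (aP i).2.
by split=> [i|gamma gP i]; [exact: (aP i).1 | exact: (aP i).2].
Qed.

(** * The theorem *)

Theorem mainTheorem2 (K : closedFieldType) (charK0 : [pchar K] =i pred0)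
    (n : nat) (n_gt0 : (0 < n)%N) :
  (forall (d' : nat) (d : 'I_n -> nat),
     exists a b : nat,
     forall (p : nat) (f : 'I_p -> {mpoly K[n]}),
       (forall k, binomial_deg_le d' (f k)) ->
     forall (i : nat) (x : 'I_n -> series2 K),
       (forall j, tz_ord (x j) (d j)) ->
       (forall k, tz_exp (a * i + b)%N (extend_coef (f k)).@[x]) ->
     exists y : 'I_n -> series2 K,
       (forall k, (extend_coef (f k)).@[y] = 0) /\
       (forall j, tz_exp i (y j - x j)))
  /\
  (forall d' : nat,
     exists beta : nat -> nat,
       doubly_exponential beta /\
       forall (I : set {mpoly K[n]}) (S : set {mpoly K[n]}),
         (forall f, S f -> binomial_deg_le d' f) ->
         I = ideal_gen S ->
         exists alpha : nat -> nat,
           is_artin_function (extend_ideal I) alpha /\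
           forall i, (alpha i <= beta i)%N).
Proof.
split=> [d' d|d'].
  (* All components are small for the threshold T = sum of the d_j. *)
  pose D := (d' * \sum_j d j)%N; exists D.+1, (D + D.+1)%N => p f fbin i x xd fx.
  have [||||||y [fy yx]] := @approx_gap K n charK0 d' (range f) x i
      (\sum_j d j)%N (i + D.+1)%N (D.+1 * i + (D + D.+1))%N.
  - by move=> _ [k _ <-].
  - move=> j; left; exists (d j) => //.
    by rewrite (bigD1 j) //= leq_addr.
  - by rewrite -/D; lia.
  - by rewrite leq_addr.
  - by rewrite -/D; nia.
  - by move=> _ [k _ <-].
  by exists y; split=> // k; apply: fy; exists k.
exists (artin_bound n d'); split.
  exists (2 * (d'.+1 * d'.+2 ^ n)).+2.+2, 1%N; split=> // E.
  exists (fun=> 1%N); split=> [e|i]; last by rewrite /E !mul1n.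
  by exists 0%N => i _; rewrite exp1n expn_gt0.
move=> I S Sbin ->.
have [alpha aJ ab] := artin_function_le (fun i => @artin_approx_bound K n charK0 d' S i Sbin).
by exists alpha.
Qed.
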